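(* Let $(G_n)_{n\in\mathbb{N}}$ be a sequence of functions from $\boldsymbol{V}$ admitting decompositions $$G_n(x)=G_n^+(x)-G_n^-(x),\quad x\in\mathbb{R},\ n\in\mathbb{N},$$ with some non-decreasing functions $G_n^+,G_n^-\in\boldsymbol{V}$ such that $$\varlimsup_{n\to\infty} G_n^-(+\infty)=M<\infty.$$ Let $g_n(t)=\int_{\mathbb{R}} e^{itx}\,dG_n(x)$, $t\in\mathbb{R}$, $n\in\mathbb{N}$. Suppose that $g_n(t)\to g(t)$, $n\to\infty$, for almost all $t\in\mathbb{R}$ (Lebesgue measure), including $t=0$, with some function $g:\mathbb{R}\to\mathbb{C}$. Then $g(0)\in\mathbb{R}$, and $B\mathrel{:=}\varlimsup_{n\to\infty}\|G_n\|$ is finite with $B\leqslant g(0)+2M$. Moreover, there exists a function $G\in\boldsymbol{V}$ such that $\|G\|\leqslant B$ and the equality $g(t)=\int_{\mathbb{R}} e^{itx}\,dG(x)$ holds for almost all $t\in\mathbb{R}$, including all continuity points $t$ of $g$; the function $G$ is uniquely determined in the class $\boldsymbol{V}$, and $(G_n)_{n\in\mathbb{N}}$ converges basically to $G$ ($G_n\Rightarrow G$, $n\to\infty$). If also $g$ is continuous at $t=0$, then additionally $G_n(+\infty)\to G(+\infty)$, $n\to\infty$.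
   Context: $\boldsymbol{V}$ denotes the class of all functions $G:\mathbb{R}\to\mathbb{R}$ of bounded variation on $\mathbb{R}$ that are right-continuous at every point and satisfy $G(-\infty)=0$, where $G(\pm\infty)$ denote the limits at $\pm\infty$. For $G\in\boldsymbol{V}$, $\|G\|$ is the total variation of $G$ on $\mathbb{R}$. Integrals $\int_{\mathbb{R}} h\,dG$ are Lebesgue--Stieltjes integrals, i.e. integrals with respect to the finite signed measure $\mu_G$ with $\mu_G((a,b])=G(b)-G(a)$. Basic convergence: for $G_n,G\in\boldsymbol{V}$, $(G_n)_{n\in\mathbb{N}}$ converges basically to $G$, written $G_n\Rightarrow G$, $n\to\infty$, if every subsequence of $(G_n)_{n\in\mathbb{N}}$ contains a further subsequence $(G_{n_k})_{k\in\mathbb{N}}$ for which there is an at most countable set $D\subset\mathbb{R}$ (depending in general on the choice of the subsequences) such that $G_{n_k}(x_2)-G_{n_k}(x_1)\to G(x_2)-G(x_1)$, $k\to\infty$, for all $x_1,x_2\in\mathbb{R}\setminus D$. *)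

(* Defs.v *)
From HB Require Import structures.
From mathcomp Require Import all_boot all_order all_algebra.
From mathcomp Require Import all_classical all_reals all_analysis.
From mathcomp Require Import complex.

Set Implicit Arguments.
Unset Strict Implicit.
Unset Printing Implicit Defensive.
Import Order.TTheory GRing.Theory Num.Theory.
Import numFieldNormedType.Exports.

Local Open Scope classical_set_scope.
Local Open Scope ring_scope.

(* MathComp-Analysis equips abstract numeric fields with the topology of their
   norm; this instance makes that topology available on R[i] itself. *)
HB.instance Definition _ (R : rcfType) := NormedModule.copy R[i] (R[i])^o.

Definition total_variationR (R : realType) (f : R -> R) : \bar R :=
  ereal_sup [set total_variation ab.1 ab.2 f |
             ab in [set ab : R * R | ab.1 <= ab.2]].

Definition class_V (R : realType) : set (R -> R) :=
  [set G | [/\ (total_variationR G < +oo)%E,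
               right_continuous G &
               G x @[x --> -oo] --> (0 : R)]].

Definition at_pinfty (R : realType) (G : R -> R) : R :=
  lim (G x @[x --> +oo]).

Definition is_stieltjes_charge (R : realType) (G : R -> R)
    (nu : {charge set (measurableTypeR R) -> \bar R}) : Prop :=
  forall a b : R, a < b -> nu `]a, b]%classic = (G b - G a)%:E.

(* Every G in class_V has a Stieltjes charge, and its values on Borel sets are
   determined by G, so the choice made here is immaterial; the zero charge is
   a dummy value for the other functions. *)
Definition stieltjes_charge (R : realType) (G : R -> R) :
    {charge set (measurableTypeR R) -> \bar R} :=
  match pselect (exists nu, @is_stieltjes_charge R G nu) with
  | left exnu => sval (cid exnu)
  | right _ => czero
  end.

(* The integral of a real function with respect to a charge is the difference
   of its integrals with respect to the two parts of the Jordan decomposition;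
   the latter do not depend on the chosen Hahn decomposition (P, N). *)
Definition charge_integral d (T : measurableType d) (R : realType)
    (nu : {charge set T -> \bar R}) (h : T -> R) : R :=
  let exN := cid (Hahn_decomposition nu) in
  let nuPN := svalP (cid (svalP exN)) in
  (\int[jordan_pos nuPN]_x h x) - (\int[jordan_neg nuPN]_x h x).

Definition stieltjes_integral (R : realType) (h : R -> R[i]) (G : R -> R) :
    R[i] :=
  Complex (charge_integral (stieltjes_charge G) (fun x => complex.Re (h x)))
          (charge_integral (stieltjes_charge G) (fun x => complex.Im (h x))).

(* exp (i y) for real y. *)
Definition expi (R : realType) (y : R) : R[i] := Complex (cos y) (sin y).

Definition fourier_stieltjes (R : realType) (G : R -> R) (t : R) : R[i] :=
  stieltjes_integral (fun x => expi (t * x)) G.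

(* Subsequences are given by strictly increasing index maps s, s'. *)
Definition basic_cvg (R : realType) (G_ : nat -> R -> R) (G : R -> R) : Prop :=
  forall s : nat -> nat, {homo s : m n / (m < n)%N} ->
  exists s' : nat -> nat, {homo s' : m n / (m < n)%N} /\
  exists D : set R, countable D /\
  forall x1 x2 : R, ~ D x1 -> ~ D x2 ->
    (G_ (s (s' k)) x2 - G_ (s (s' k)) x1) @[k --> \oo] --> G x2 - G x1.

(* Main.v *)
Require Import Defs.
From HB Require Import structures.
From mathcomp Require Import all_boot all_order all_algebra.
From mathcomp Require Import all_classical all_reals all_analysis.
From mathcomp Require Import measurable_realfun complex.
From mathcomp Require Import ring lra.

Set Implicit Arguments.
Unset Strict Implicit.
Unset Printing Implicit Defensive.
Import Order.TTheory GRing.Theory Num.Theory.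
Import numFieldNormedType.Exports.

Local Open Scope classical_set_scope.
Local Open Scope ring_scope.

(** Write the transforms of G_ n as differences of transforms of the finite
   measures of Gp n and Gm n.  At t = 0 they are the differences of the total
   masses, so these masses are eventually bounded, and the total variation of
   G_ n, at most Gp n (+oo) + Gm n (+oo) = G_ n (+oo) + 2 Gm n (+oo), has an
   upper limit at most g(0) + 2 M.

   By Helly's theorem ([helly_selection]) every subsequence has a further one
   along which Gp n and Gm n converge off a countable set, up to constants to
   non-decreasing functions of V; let G be the difference of the latter.  Mass
   may escape to infinity, so the transforms need not converge to that of G
   pointwise, but their averages over segments do: by Fubini such an average is
   the integral of a function vanishing at infinity, to which vague convergence
   applies ([vague_cvg_Rintegral]).  By dominated convergence the averages also
   converge to those of g, hence g is the transform of G almost everywhere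
   ([vague_cvg_transform_ae], [basic_subsequence]).

   Almost everywhere, the transform determines G ([fourier_stieltjes_uniq]): it
   is continuous, so it is known everywhere, and integrating it against
   exp (- e t) recovers the integrals of the Poisson kernels, whose averages
   over segments approximate indicators ([finite_measure_fourier_uniq]).  So
   all subsequences lead to the same G, which is basic convergence.  The bound
   on the variation of G is lower semicontinuity
   ([total_variationR_le_limit]), and at a continuity point of g two functions
   that agree almost everywhere agree ([ae_eq_at_continuity]); at 0 this
   compares the masses at +oo. *)

Local Notation finmeasure R :=
  {finite_measure set (measurableTypeR R) -> \bar R}.

Local Notation rat_functions R :=
  (prod_topology (fun _ : rat => R : topologicalType)).

(** * Finite measures on the line and Stieltjes charges *)

Lemma bounded_integrable_lty d (T : measurableType d) (R : realType)
    (mu : {measure set T -> \bar R}) (D : set T) (h : T -> R) (C : R) :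
  measurable D -> (mu D < +oo)%E -> measurable_fun D h ->
  (forall x, D x -> `|h x| <= C) ->
  mu.-integrable D (EFin \o h).
Proof.
move=> mD muD mh hC; apply: measurable_bounded_integrable => //.
exists C; split; first exact: num_real.
by move=> M CM x Dx; exact: le_trans (hC x Dx) (ltW CM).
Qed.

Lemma finite_measure_lty d (T : measurableType d) (R : realType)
    (mu : {finite_measure set T -> \bar R}) (D : set T) :
  measurable D -> (mu D < +oo)%E.
Proof. by move=> mD; rewrite -ge0_fin_numE// fin_num_measure. Qed.

Lemma bounded_integrable d (T : measurableType d) (R : realType)
    (mu : {finite_measure set T -> \bar R}) (D : set T) (h : T -> R) (C : R) :
  measurable D -> measurable_fun D h -> (forall x, D x -> `|h x| <= C) ->
  mu.-integrable D (EFin \o h).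
Proof.
by move=> mD; apply: bounded_integrable_lty => //; exact: finite_measure_lty.
Qed.

Lemma bounded_cvg_Rintegral d (T : measurableType d) (R : realType)
    (mu : {measure set T -> \bar R}) (D : set T) (f_ : nat -> T -> R)
    (f : T -> R) (C : R) :
  measurable D -> (mu D < +oo)%E -> (forall n, measurable_fun D (f_ n)) ->
  measurable_fun D f -> (forall n x, D x -> `|f_ n x| <= C) ->
  {ae mu, forall x, D x -> f_ n x @[n --> \oo] --> f x} ->
  \int[mu]_(x in D) f_ n x @[n --> \oo] --> \int[mu]_(x in D) f x.
Proof.
move=> mD muD mf_ mf fC ff.
have iC : mu.-integrable D (EFin \o cst C).
  by apply: (@bounded_integrable_lty _ _ _ _ _ _ `|C|) => //.
have [] := @dominated_convergence _ _ _ mu D mD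
    (fun n => EFin \o f_ n) (EFin \o f) (EFin \o cst C) _ _ _ iC.
- by move=> n; exact/measurable_EFinP.
- exact/measurable_EFinP.
- apply: filterS ff => x fx Dx; apply: cvg_EFin; first by near=> n.
  exact: fx.
- by apply: aeW => x n Dx; rewrite lee_fin fC.
move=> fi _ DC; apply: fine_cvg; rewrite fineK//; exact: integrable_fin_num.
Unshelve. all: end_near. Qed.

Lemma finite_measure_eq_ocitv (R : realType)
    (m1 m2 : finmeasure R) :
  (forall a b : R, a < b -> m1 `]a, b]%classic = m2 `]a, b]%classic) ->
  forall A : set (measurableTypeR R), measurable A -> m1 A = m2 A.
Proof.
move=> m12 A mA.
apply: (@measure_unique _ R (measurableTypeR R) (@ocitv R)
  (fun n => `]- n%:R, n%:R]%classic)) => //.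
- exact: ocitvI.
- by move=> n; exact: is_ocitv.
- exact: (bigcup_itvT false false).
- move=> X /ocitvP[->|[[a b] /= ab ->]]; first by rewrite !measure0.
  exact: m12.
- by move=> n; rewrite -ge0_fin_numE// fin_num_measure.
Qed.

Lemma Rintegral_eq_measure d (T : measurableType d) (R : realType)
    (m1 m2 : {measure set T -> \bar R}) (D : set T) (f : T -> R) :
  (forall A, measurable A -> A `<=` D -> m1 A = m2 A) ->
  \int[m1]_(x in D) f x = \int[m2]_(x in D) f x.
Proof. by move=> m12; congr fine; exact: eq_measure_integral. Qed.

Lemma Rintegral_measure_add d (T : measurableType d) (R : realType)
    (m1 m2 : {finite_measure set T -> \bar R}) (h : T -> R) (C : R) :
  measurable_fun [set: T] h -> (forall x, `|h x| <= C) ->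
  \int[measure_add m1 m2]_x h x = \int[m1]_x h x + \int[m2]_x h x.
Proof.
move=> mh hC.
have i1 : m1.-integrable setT (EFin \o h).
  by apply: bounded_integrable => // x _; exact: hC.
have i2 : m2.-integrable setT (EFin \o h).
  by apply: bounded_integrable => // x _; exact: hC.
rewrite /Rintegral (integral_measure_add _ i1 i2)//.
by rewrite fineD//; exact: integrable_fin_num.
Qed.

Lemma finite_measure_of_measure d (T : measurableType d) (R : realType)
    (m : {measure set T -> \bar R}) : (m setT < +oo)%E ->
  exists mu : {finite_measure set T -> \bar R}, mu = m :> (set T -> \bar R).
Proof.
move=> mT; exists (mfrestr measurableT mT); apply/funext => A.
by rewrite /= /mfrestr /mrestr setIT.
Qed.

(** Moving the subtracted measures to the other side turns an identity between
   differences into one between two finite measures, which half-open intervals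
   determine. *)
Lemma Rintegral_sub_eq (R : realType)
    (a b a' b' : finmeasure R)
    (h : R -> R) (C : R) :
  (forall x y : R, x < y ->
    (a `]x, y]%classic + b' `]x, y]%classic =
     a' `]x, y]%classic + b `]x, y]%classic)%E) ->
  measurable_fun [set: measurableTypeR R] h -> (forall x, `|h x| <= C) ->
  \int[a]_x h x - \int[b]_x h x = \int[a']_x h x - \int[b']_x h x.
Proof.
move=> ab mh hC.
apply/eqP; rewrite subr_eq addrAC eq_sym subr_eq eq_sym.
rewrite -!(Rintegral_measure_add _ _ mh hC); apply/eqP.
apply: Rintegral_eq_measure => A mA _.
have mfin m : m = measure_add a b' \/ m = measure_add a' b -> (m setT < +oo)%E.
  by move=> [->|->]; rewrite measure_addE lte_add_pinfty// -ge0_fin_numE//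
    fin_num_measure.
have [m1 m1E] := finite_measure_of_measure (mfin _ (or_introl erefl)).
have [m2 m2E] := finite_measure_of_measure (mfin _ (or_intror erefl)).
rewrite -m1E -m2E; apply: finite_measure_eq_ocitv => // x y xy.
by rewrite m1E m2E [LHS]measure_addE [RHS]measure_addE ab.
Qed.

Lemma stieltjes_chargeP (R : realType) (G : R -> R)
    (a b : finmeasure R) :
  (forall x y : R, x < y ->
    (a `]x, y]%classic - b `]x, y]%classic = (G y - G x)%:E)%E) ->
  is_stieltjes_charge G (stieltjes_charge G).
Proof.
move=> abG; rewrite /stieltjes_charge; case: pselect => [ex|]; last first.
  case; exists (cadd (charge_of_finite_measure a)
    (copp (charge_of_finite_measure b))).
  by move=> x y /abG.
exact: svalP (cid ex).
Qed.

(** Any pair of finite measures whose difference has the increments of G may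
   replace the Jordan decomposition of its charge: this is what makes the
   integral against G computable from a decomposition of G. *)
Lemma charge_integralE (R : realType) (G h : R -> R) (C : R)
    (a b : finmeasure R) :
  (forall x y : R, x < y ->
    (a `]x, y]%classic - b `]x, y]%classic = (G y - G x)%:E)%E) ->
  measurable_fun [set: measurableTypeR R] h -> (forall x, `|h x| <= C) ->
  charge_integral (stieltjes_charge G) h = \int[a]_x h x - \int[b]_x h x.
Proof.
move=> abG mh hC; rewrite /charge_integral.
set PN := (X in jordan_pos X).
apply: (Rintegral_sub_eq _ mh hC) => x y xy.
have aux (p n u v : \bar R) : p \is a fin_num -> n \is a fin_num ->
    u \is a fin_num -> v \is a fin_num -> (p - n = u - v)%E ->
    (p + v = u + n)%E.
  move: p n u v => [p||] [n||] [u||] [v||]//= _ _ _ _.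
  by rewrite -!EFinD => -[] pnuv; congr (_%:E); lra.
have mI : measurable (`]x, y]%classic : set (measurableTypeR R)).
  exact: measurable_itv.
apply: aux; [exact: fin_num_measure..|].
rewrite abG// -(stieltjes_chargeP abG xy) (jordan_decomp PN)//.
by rewrite /cadd/= cscaleN1.
Qed.

(** The masses of the half-lines come from those of the half-open intervals by
   exhaustion from below. *)
Lemma stieltjes_measure (R : realType) (F : R -> R) (l : R) :
  nondecreasing F -> right_continuous F ->
  F x @[x --> -oo] --> (0 : R) -> F x @[x --> +oo] --> l ->
  exists mu : finmeasure R,
    (forall x, mu `]-oo, x]%classic = (F x)%:E) /\ mu setT = l%:E.
Proof.
move=> Fnd Frc F0 Fl.
pose F' : cumulative R R := HB.pack F (isCumulative.Build R _ R F Fnd Frc).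
pose lsf := lebesgue_stieltjes_measure F'.
have lsfE (x y : R) : x <= y -> lsf `]x, y]%classic = (F y - F x)%:E.
  move=> xy; rewrite /lsf/= /lebesgue_stieltjes_measure /measure_extension.
  by rewrite measurable_mu_extE/= ?wlength_itv_bnd//; exact: is_ocitv.
have lsfx (x : R) : lsf `]-oo, x]%classic = (F x)%:E.
  pose I n : set R := `]x - n%:R, x]%classic.
  have bI : \bigcup_n I n = `]-oo, x]%classic.
    apply/seteqP; split=> [y [n _]|y]; rewrite /I/= !in_itv/=.
      by move=> /andP[].
    move=> yx; have [n xyn] : exists n : nat, x - y < n%:R.
      exists (Num.truncn (x - y)).+1; rewrite truncnS_gt//.
    by exists n => //=; rewrite in_itv/= yx andbT ltrBlDr -ltrBlDl.
  have : (lsf \o I) n @[n --> \oo] --> (F x)%:E.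
    have -> : lsf \o I = (fun n => (F x - F (x - n%:R))%:E).
      by apply/funext => n /=; rewrite lsfE// lerBlDr lerDl.
    apply: cvg_EFin; first by near=> n.
    rewrite -[X in _ --> X](subr0 (F x)); apply: cvgB; first exact: cvg_cst.
    apply: (cvg_comp (fun n : nat => x - n%:R) F _ F0).
    apply/cvgrNyPle => A; near=> n; rewrite lerBlDr -lerBlDl.
    by near: n; exact: nbhs_infty_ger.
  have : (lsf \o I) n @[n --> \oo] --> lsf (\bigcup_n I n).
    apply: nondecreasing_cvg_mu; rewrite /I//; first exact: bigcup_measurable.
    move=> m n mn; apply/subsetPset/subset_itv; rewrite leBSide/=//.
    by rewrite lerD2l lerN2 ler_nat.
  rewrite bI; exact: cvg_unique.
have lsfT : lsf setT = l%:E.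
  pose I n : set R := `]-oo, n%:R]%classic.
  have bI : \bigcup_n I n = setT.
    apply/seteqP; split=> [//|y _]; exists (Num.truncn y).+1 => //=.
    by rewrite /I/= in_itv/= ltW// truncnS_gt.
  have : (lsf \o I) n @[n --> \oo] --> l%:E.
    have -> : lsf \o I = (fun n => (F n%:R)%:E).
      by apply/funext => n /=; rewrite lsfx.
    apply: cvg_EFin; first by near=> n.
    exact: (cvg_comp (fun n : nat => n%:R) F (@cvgr_idn R) Fl).
  have : (lsf \o I) n @[n --> \oo] --> lsf (\bigcup_n I n).
    apply: nondecreasing_cvg_mu; rewrite /I//; first exact: bigcup_measurable.
    move=> m n mn; apply/subsetPset/subset_itvl; rewrite leBSide/=.
    by rewrite ler_nat.
  rewrite bI; exact: cvg_unique.
have lsf_lty : (lsf setT < +oo)%E.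
  by apply: (le_lt_trans _ (ltry l)); rewrite -lsfT.
have [mu muE] := finite_measure_of_measure lsf_lty.
by exists mu; rewrite muE.
Unshelve. all: end_near. Qed.

(** * Functions of bounded variation on the line *)

Lemma nondecreasing_cvg_ninfty (R : realType) (f : R -> R) :
  nondecreasing f -> has_lbound (range f) ->
  f x @[x --> -oo] --> inf (range f).
Proof.
move=> fnd flb; apply/cvgrPdist_le => e e0.
have hinf : has_inf (range f) by split => //; exists (f 0), 0.
have [_ [x _ <-] fx] := inf_adherent e0 hinf.
exists x; split; first exact: num_real.
move=> y yx.
have yi : inf (range f) <= f y by apply: ge_inf => //; exists y.
rewrite distrC ger0_norm ?subr_ge0// lerBlDl.
by rewrite (le_trans _ (ltW fx))// fnd// ltW.
Qed.

Lemma nondecreasing_total_variationR_le (R : realType) (f : R -> R) (c d : R) :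
  nondecreasing f -> (forall x, c <= f x <= d) ->
  (total_variationR f <= (d - c)%:E)%E.
Proof.
move=> fnd fcd; apply: ge_ereal_sup => _ [[a b] /= ab <-].
rewrite nondecreasing_total_variation//; last first.
  by move=> x y _ _; exact: fnd.
rewrite lee_fin lerB//.
- by have /andP[] := fcd b.
- by have /andP[] := fcd a.
Qed.

Lemma nondecreasing_class_V (R : realType) (f : R -> R) (c d : R) :
  nondecreasing f -> right_continuous f -> (forall x, c <= f x <= d) ->
  class_V (fun x => f x - inf (range f)).
Proof.
move=> fnd frc fcd; split.
- apply: (le_lt_trans (@nondecreasing_total_variationR_le _ _
    (c - inf (range f)) (d - inf (range f)) _ _)); last exact: ltry.
    by move=> x y xy; rewrite lerD2r fnd.
  by move=> x; rewrite !lerD2r.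
- by move=> x; apply: cvgB; [exact: frc|exact: cvg_cst].
- rewrite -[X in _ --> X](subrr (inf (range f))).
  apply: cvgB; last exact: cvg_cst.
  apply: nondecreasing_cvg_ninfty => //.
  by exists c => _ [x _ <-]; have /andP[] := fcd x.
Qed.

Lemma total_variation_leR (R : realType) (G : R -> R) (a b : R) :
  a <= b -> (total_variation a b G <= total_variationR G)%E.
Proof. by move=> ab; apply: ereal_sup_ubound; exists (a, b). Qed.

Lemma total_variation_fin (R : realType) (G : R -> R) (a b : R) :
  (total_variationR G < +oo)%E -> a <= b ->
  total_variation a b G \is a fin_num.
Proof.
move=> GV ab; rewrite ge0_fin_numE ?total_variation_ge0//.
exact: le_lt_trans (total_variation_leR G ab) GV.
Qed.

(** The primitive of the variation of G, normalized to vanish at 0: reading it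
   off total variations over [0, x] and [x, 0] avoids a supremum over all left
   end points.  For x != 0 one of the two terms is the supremum of an empty
   family of variations, -oo, whose real part is 0. *)
Definition signed_variation (R : realType) (G : R -> R) (x : R) : R :=
  fine (total_variation 0 x G) - fine (total_variation x 0 G).

Lemma total_variation_reversed (R : realType) (G : R -> R) (a b : R) :
  b < a -> total_variation a b G = -oo%E.
Proof.
move=> ba; rewrite /total_variation.
rewrite (_ : [set x%:E | x in _] = set0) ?ereal_sup0//.
apply/seteqP; split=> // _ [_ [s abs <-] <-].
by have := itv_partition_le abs; rewrite leNgt ba.
Qed.

(** Additivity of the total variation, whichever side of 0 the two points lie
   on. *)
Lemma signed_variationB (R : realType) (G : R -> R) (x y : R) :
  (total_variationR G < +oo)%E -> x <= y ->
  signed_variation G y - signed_variation G x = fine (total_variation x y G).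
Proof.
move=> GV xy; rewrite /signed_variation.
have fin a b : a <= b -> total_variation a b G \is a fin_num.
  exact: total_variation_fin.
have [x0|x0] := leP 0 x.
  have y0 : 0 <= y by exact: le_trans xy.
  have zE z : 0 <= z -> fine (total_variation z 0 G) = 0.
    rewrite le_eqVlt => /predU1P[<-|z0]; first by rewrite total_variationxx.
    by rewrite total_variation_reversed.
  rewrite !zE// (total_variationD G x0 xy) fineD ?fin//; lra.
have [y0|y0] := leP 0 y.
  rewrite (total_variation_reversed G x0) /=.
  rewrite (total_variationD G (ltW x0) y0) fineD ?fin//; last exact: ltW.
  have -> : fine (total_variation y 0 G) = 0; last by lra.
  move: y0; rewrite le_eqVlt => /predU1P[<-|y0].
    by rewrite total_variationxx.
  by rewrite total_variation_reversed.
rewrite !(total_variation_reversed G x0) !(total_variation_reversed G y0) /=.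
rewrite (total_variationD G xy (ltW y0)) fineD ?fin//; last exact: ltW.
lra.
Qed.

Lemma signed_variation_dist (R : realType) (G : R -> R) (x y : R) :
  (total_variationR G < +oo)%E -> x <= y ->
  `|G y - G x| <= signed_variation G y - signed_variation G x.
Proof.
move=> GV xy; rewrite signed_variationB// -lee_fin fineK.
  exact: total_variation_ge.
exact: total_variation_fin.
Qed.

Lemma signed_variation_right_continuous (R : realType) (G : R -> R) :
  (total_variationR G < +oo)%E -> right_continuous G ->
  right_continuous (signed_variation G).
Proof.
move=> GV Grc x.
have BVx : bounded_variation x (x + 1) G.
  by apply/bounded_variationP; [rewrite lerDl|
    apply: total_variation_fin => //; rewrite lerDl].
have xx1 : x < x + 1 by rewrite ltrDl.
have := total_variation_right_continuous (lexx x) xx1 (Grc x) BVx.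
rewrite total_variationxx /= => H.
rewrite -[X in _ --> X](addr0 (signed_variation G x)).
have : signed_variation G x + (fine \o total_variation x ^~ G) y
    @[y --> x^'+] --> signed_variation G x + 0.
  by apply: cvgD => //; exact: cvg_cst.
apply: cvg_trans; apply: near_eq_cvg; near=> y.
rewrite /= -signed_variationB//; first by rewrite addrC subrK.
Unshelve. all: end_near. Qed.

Lemma class_V_bounded (R : realType) (G : R -> R) : class_V G ->
  exists C, forall x, `|G x| <= C.
Proof.
move=> [GV _ G0].
have TVfin : total_variationR G \is a fin_num.
  rewrite ge0_fin_numE//.
  by rewrite (le_trans _ (total_variation_leR G (lexx 0)))// total_variationxx.
exists (fine (total_variationR G) + `|G 0|) => x.
have GG a b : a <= b -> `|G b - G a| <= fine (total_variationR G).
  move=> ab; rewrite -lee_fin fineK//.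
  exact: le_trans (total_variation_ge _ ab) (total_variation_leR G ab).
rewrite -[X in `|X|](subrK (G 0)) (le_trans (ler_normD _ _))// lerD2r.
have [x0|/ltW x0] := leP 0 x; first exact: GG.
by rewrite distrC; exact: GG.
Qed.

(** Since the increments of G are dominated by those of its signed variation S,
   both S + G and S - G are non-decreasing.  Their halves differ by G, and as G
   vanishes at -oo they have the same limit there, so that subtracting this
   limit from both leaves the difference unchanged. *)
Lemma class_V_jordan (R : realType) (G : R -> R) : class_V G ->
  exists P N : R -> R, [/\ class_V P, class_V N, nondecreasing P,
    nondecreasing N & forall x, G x = P x - N x].
Proof.
move=> GV; have [GTV Grc G0] := GV.
have [C GC] := class_V_bounded GV.
pose S := signed_variation G.
have Sdist x y : x <= y -> `|G y - G x| <= S y - S x.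
  exact: signed_variation_dist.
pose P x := (S x + G x) / 2; pose N x := (S x - G x) / 2.
have Snd : nondecreasing S.
  by move=> x y xy; rewrite -subr_ge0 (le_trans _ (Sdist x y xy)).
have Pnd : nondecreasing P.
  by move=> x y /Sdist; rewrite ler_norml /P => /andP[]; lra.
have Nnd : nondecreasing N.
  by move=> x y /Sdist; rewrite ler_norml /N => /andP[]; lra.
have Src : right_continuous S by exact: signed_variation_right_continuous.
have Prc : right_continuous P.
  by move=> x; apply: cvgMl; apply: cvgD; [exact: Src|exact: Grc].
have Nrc : right_continuous N.
  by move=> x; apply: cvgMl; apply: cvgB; [exact: Src|exact: Grc].
pose D := fine (total_variationR G).
have SD x : - D <= S x <= D.
  have DE a b : a <= b -> fine (total_variation a b G) <= D.
    move=> ab; apply: fine_le.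
    - exact: total_variation_fin.
    - rewrite ge0_fin_numE//.
      rewrite (le_trans _ (total_variation_leR G (lexx 0)))//.
      by rewrite total_variationxx.
    - exact: total_variation_leR.
  have S0 : S 0 = 0 by rewrite /S /signed_variation subrr.
  have [x0|/ltW x0] := leP 0 x.
    have := DE _ _ x0; have := Snd _ _ x0; rewrite -signed_variationB// S0.
    by rewrite -/S S0; lra.
  have := DE _ _ x0; have := Snd _ _ x0; rewrite -signed_variationB// S0.
  by rewrite -/S S0; lra.
have PB x : (- D - C) / 2 <= P x <= (D + C) / 2.
  by have := SD x; have := GC x; rewrite ler_norml /P; lra.
have NB x : (- D - C) / 2 <= N x <= (D + C) / 2.
  by have := SD x; have := GC x; rewrite ler_norml /N; lra.
exists (fun x => P x - inf (range P)), (fun x => N x - inf (range N)).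
split.
- exact: nondecreasing_class_V PB.
- exact: nondecreasing_class_V NB.
- by move=> x y xy; rewrite lerD2r Pnd.
- by move=> x y xy; rewrite lerD2r Nnd.
move=> x.
have PN : inf (range P) = inf (range N).
  have PC : P x @[x --> -oo] --> inf (range P).
    apply: nondecreasing_cvg_ninfty => //.
    by exists ((- D - C) / 2) => _ [z _ <-]; have /andP[] := PB z.
  have : N x @[x --> -oo] --> inf (range N).
    apply: nondecreasing_cvg_ninfty => //.
    by exists ((- D - C) / 2) => _ [z _ <-]; have /andP[] := NB z.
  have NE : N = fun x => P x - G x by apply/funext => z; rewrite /N /P; lra.
  have : P x - G x @[x --> -oo] --> inf (range P) - 0 by exact: cvgB.
  by rewrite subr0 -NE; exact: cvg_unique.
by rewrite PN /P /N; lra.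
Qed.

Lemma nondecreasing_class_V_cvg (R : realType) (F : R -> R) :
  class_V F -> nondecreasing F -> F x @[x --> +oo] --> at_pinfty F.
Proof.
move=> FV Fnd; have [C FC] := class_V_bounded FV.
have : F x @[x --> +oo] --> sup (range F).
  apply: nondecreasing_cvgr => //; exists C => _ [x _ <-].
  by rewrite (le_trans (ler_norm _)).
by rewrite /at_pinfty => /[dup] /cvg_lim ->.
Qed.

Lemma nondecreasing_class_V_bound (R : realType) (F : R -> R) :
  class_V F -> nondecreasing F -> forall x, 0 <= F x <= at_pinfty F.
Proof.
move=> FV Fnd x; have [C FC] := class_V_bounded FV.
have ub : has_ubound (range F).
  by exists C => _ [y _ <-]; rewrite (le_trans (ler_norm _)).
have lb : has_lbound (range F).
  by exists (- C) => _ [y _ <-]; have := FC y; rewrite ler_norml => /andP[].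
have [_ _ F0] := FV; apply/andP; split.
  rewrite -(cvg_unique _ (nondecreasing_cvg_ninfty Fnd lb) F0)//.
  by apply: ge_inf => //; exists x.
have Fl := nondecreasing_class_V_cvg FV Fnd.
rewrite -(cvg_unique _ (nondecreasing_cvgr Fnd ub) Fl)//.
by apply: ub_le_sup => //; exists x.
Qed.

(** The link between the functions of V and measures: the measure of a
   non-decreasing F in V has distribution function F. *)
Lemma nondecreasing_class_V_measure (R : realType) (F : R -> R) :
  class_V F -> nondecreasing F ->
  exists mu : finmeasure R,
    (forall x, mu `]-oo, x]%classic = (F x)%:E) /\ mu setT = (at_pinfty F)%:E.
Proof.
move=> FV Fnd; have [_ Frc F0] := FV.
exact: stieltjes_measure (nondecreasing_class_V_cvg FV Fnd).
Qed.

Lemma finite_measure_itvoc (R : realType) (F : R -> R) (x y : R)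
    (mu : finmeasure R) :
  (forall x, mu `]-oo, x]%classic = (F x)%:E) -> x <= y ->
  mu `]x, y]%classic = (F y - F x)%:E.
Proof.
move=> muF xy.
have -> : `]x, y]%classic = `]-oo, y] `\` `]-oo, x].
  apply/seteqP; split=> z /=; rewrite !in_itv/=.
    by move=> /andP[xz zy]; split => //; apply/negP; rewrite -ltNge.
  by move=> [zy /negP]; rewrite -ltNge zy andbT.
have mI z : measurable (`]-oo, z]%classic : set (measurableTypeR R)).
  exact: measurable_itv.
have yx : `]-oo, y] `&` `]-oo, x] = `]-oo, x]%classic :> set R.
  by rewrite setIidr//; apply: subset_itvl; rewrite bnd_simp.
rewrite measureD//; last by apply: (le_lt_trans _ (ltry (F y))); rewrite -muF.
by rewrite yx EFinB; congr (_ - _)%E; exact: muF.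
Qed.

(** Reduction of the complex transform of G to real integrals against two
   finite measures. *)
Lemma fourier_stieltjesE (R : realType) (G P N : R -> R) (t : R)
    (a b : finmeasure R) :
  (forall x, a `]-oo, x]%classic = (P x)%:E) ->
  (forall x, b `]-oo, x]%classic = (N x)%:E) ->
  (forall x, G x = P x - N x) ->
  fourier_stieltjes G t =
    Complex (\int[a]_x cos (t * x) - \int[b]_x cos (t * x))
            (\int[a]_x sin (t * x) - \int[b]_x sin (t * x)).
Proof.
move=> aP bN GPN; rewrite /fourier_stieltjes /stieltjes_integral /=.
have ab x y : x < y ->
    (a `]x, y]%classic - b `]x, y]%classic = (G y - G x)%:E)%E.
  move=> /ltW xy; rewrite (finite_measure_itvoc aP xy).
  by rewrite (finite_measure_itvoc bN xy) -EFinB !GPN; congr (_%:E); lra.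
have mt : measurable_fun setT (fun x : measurableTypeR R => t * x).
  exact: measurable_funM.
congr Complex; apply: (charge_integralE ab).
- apply: measurableT_comp mt; apply: continuous_measurable_fun.
  exact: continuous_cos.
- by move=> x; exact: cos_max.
- apply: measurableT_comp mt; apply: continuous_measurable_fun.
  exact: continuous_sin.
- by move=> x; exact: sin_max.
Qed.

(** * Uniqueness of a finite measure with given transform *)

Lemma derivable_continuous (R : realType) (f : R -> R) :
  (forall x : R, derivable f x (1 : R)) -> continuous f.
Proof.
by move=> df x; apply: differentiable_continuous; apply/derivable1_diffP.
Qed.

Lemma is_derive_FTC2 (R : realType) (f F : R -> R) (a b : R) :
  a < b -> continuous f -> (forall x : R, is_derive x (1 : R) F (f x)) ->
  (\int[@lebesgue_measure R]_(x in `[a, b]) (f x)%:E = (F b - F a)%:E)%E.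
Proof.
move=> ab cf dF.
have cF : continuous F.
  by apply: derivable_continuous => x; case: (dF x).
rewrite (continuous_FTC2 ab _ _ _ (F := F))//.
- exact: continuous_subspaceT.
- split.
  + by move=> x _; case: (dF x).
  + by apply: cvg_at_right_filter; exact: cF.
  + by apply: cvg_at_left_filter; exact: cF.
- by move=> x _; rewrite derive1E; case: (dF x).
Qed.

Lemma is_derive_FTC2y (R : realType) (f F : R -> R) (a l : R) :
  (forall x, 0 <= f x) -> continuous f ->
  (forall x : R, is_derive x (1 : R) F (f x)) ->
  F x @[x --> +oo] --> l ->
  (\int[@lebesgue_measure R]_(x in `[a, +oo[) (f x)%:E = (l - F a)%:E)%E.
Proof.
move=> f0 cf dF Fl.
have cF : continuous F.
  by apply: derivable_continuous => x; case: (dF x).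
rewrite (ge0_continuous_FTC2y _ _ Fl)//.
- exact: continuous_subspaceT.
- by apply: cvg_at_right_filter; exact: cF.
- by move=> x _; rewrite derive1E; case: (dF x).
Qed.

(** The real part of the Laplace transform of an exponential.  Adding 1 to the
   cosine keeps the integrand non-negative, which is what the fundamental
   theorem of calculus on a half-line and later Tonelli's theorem ask for. *)
Lemma laplace_1Dcos (R : realType) (e u : R) : 0 < e ->
  (\int[@lebesgue_measure R]_(t in `[0%R, +oo[)
     (expR (- (e * t)) * (1 + cos (t * u)))%:E =
   (e^-1 + e / (e ^+ 2 + u ^+ 2))%:E)%E.
Proof.
move=> e0.
(* the antiderivative that two integrations by parts give *)
pose F (t : R) := expR (- (e * t)) *
  (- e^-1 + (u * sin (t * u) - e * cos (t * u)) / (e ^+ 2 + u ^+ 2)).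
have eu0 : e ^+ 2 + u ^+ 2 != 0 by rewrite gt_eqF// ltr_pwDl ?exprn_gt0 ?sqr_ge0.
have e0' : e != 0 by rewrite gt_eqF.
have dF (t : R) :
    is_derive t (1 : R) F (expR (- (e * t)) * (1 + cos (t * u))).
  rewrite /F; apply: is_derive_eq.
  by rewrite /GRing.scale/=; field; rewrite e0' eu0.
have Fl : F x @[x --> +oo] --> (0 : R).
  pose K := e^-1 + (`|u| + e) / (e ^+ 2 + u ^+ 2).
  have eul : 0 < e ^+ 2 + u ^+ 2 by rewrite ltr_pwDl ?exprn_gt0 ?sqr_ge0.
  have FK t : `|F t| <= expR (- (e * t)) * K.
    rewrite /F normrM gtr0_norm ?expR_gt0// ler_wpM2l ?expR_ge0//.
    rewrite (le_trans (ler_normD _ _))// normrN gtr0_norm ?invr_gt0//.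
    rewrite lerD2l normrM [X in _ * X]gtr0_norm ?invr_gt0//.
    apply: ler_wpM2r; first by rewrite invr_ge0 ltW.
    rewrite (le_trans (ler_normB _ _))// !normrM (gtr0_norm e0).
    by rewrite lerD// ler_piMr ?sin_max ?cos_max ?(ltW e0).
  have e0l : expR (- (e * t)) * K @[t --> +oo] --> (0 : R).
    rewrite -[X in _ --> X](mul0r K); apply: cvgMl.
    apply: (cvg_comp ( *%R e) (fun t => expR (- t)) _ (@cvgr_expR R)).
    apply/cvgryPge => A; exists (A / e); split; first exact: num_real.
    by move=> s /ltW; rewrite ler_pdivrMr// mulrC.
  apply: (squeeze_cvgr (f := fun t => - (expR (- (e * t)) * K)) _ _ e0l).
    by near=> t; have := FK t; rewrite ler_norml.
  by rewrite -[X in _ --> X]oppr0; exact: cvgN.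
rewrite (is_derive_FTC2y _ _ _ dF Fl).
- rewrite /F mulr0 oppr0 mul0r expR0 sin0 cos0; congr (_%:E).
  by field; rewrite e0' eu0.
- by move=> t; rewrite mulr_ge0 ?expR_ge0//; have := cos_geN1 (t * u); lra.
- by apply: derivable_continuous => t; exact: ex_derive.
Unshelve. all: end_near. Qed.

(** Averaging Poisson kernels over a segment gives a difference of arctangents,
   a smooth approximation of a multiple of the indicator of the segment; the
   first summand is the trace of the 1 added to the cosine. *)
Lemma poisson_atan (R : realType) (e x p q : R) : 0 < e -> p < q ->
  (\int[@lebesgue_measure R]_(y in `[p, q])
     (e^-1 + e / (e ^+ 2 + (x - y) ^+ 2))%:E =
   ((q - p) / e + (atan ((q - x) / e) - atan ((p - x) / e)))%:E)%E.
Proof.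
move=> e0 pq.
have ey0 y : 1 + ((y - x) / e) ^+ 2 != 0.
  by rewrite gt_eqF// ltr_pwDl ?sqr_ge0.
have ey0' y : e ^+ 2 + (x - y) ^+ 2 != 0.
  by rewrite gt_eqF// ltr_pwDl ?exprn_gt0 ?sqr_ge0.
have e0' : e != 0 by rewrite gt_eqF.
pose F (y : R) := y / e + atan ((y - x) / e).
have dF (y : R) :
    is_derive y (1 : R) F (e^-1 + e / (e ^+ 2 + (x - y) ^+ 2)).
  rewrite /F; apply: is_derive_eq.
  have -> : 1 + ((y - x) / e) ^+ 2 = (e ^+ 2 + (x - y) ^+ 2) / e ^+ 2.
    by field.
  by rewrite /GRing.scale/=; field; rewrite e0' ey0'.
rewrite (is_derive_FTC2 pq _ dF).
  by congr (_%:E); rewrite /F mulrBl; lra.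
move=> y; apply: cvgD; first exact: cvg_cst.
apply: cvgMr; apply: cvgV => //.
apply: cvgD; first exact: cvg_cst.
by apply: cvgM; apply: cvgB => //; exact: cvg_cst.
Qed.

Lemma tonelli_finite_lebesgue (R : realType)
    (a : finmeasure R)
    (D : set (measurableTypeR R)) (f : R -> R -> R) :
  measurable D ->
  measurable_fun setT
    (fun z : measurableTypeR R * measurableTypeR R => f z.1 z.2) ->
  (forall x t, 0 <= f x t) ->
  (\int[a]_x \int[@lebesgue_measure R]_(t in D) (f x t)%:E =
   \int[@lebesgue_measure R]_(t in D) \int[a]_x (f x t)%:E)%E.
Proof.
move=> mD mf f0.
pose g (z : measurableTypeR R * measurableTypeR R) : \bar R :=
  ((f z.1 z.2) * \1_D z.2)%:E.
have mg : measurable_fun setT g.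
  apply/measurable_EFinP; apply: measurable_funM => //.
  by apply: measurableT_comp => //; exact: measurable_indic.
have g0 z : (0 <= g z)%E by rewrite lee_fin mulr_ge0.
have := fubini_tonelli (m1 := a) (m2 := @lebesgue_measure R) g mg g0.
rewrite /g /= => E.
transitivity (\int[a]_x \int[@lebesgue_measure R]_y (f x y * \1_D y)%:E)%E.
  apply: eq_integral => x _; rewrite integral_mkcond.
  apply: eq_integral => t _; rewrite patchE indicE.
  by case: (t \in D); rewrite ?mulr1 ?mulr0.
rewrite E [RHS]integral_mkcond.
apply: eq_integral => t _; rewrite patchE indicE.
case: (t \in D); first by under eq_integral do rewrite mulr1.
by under eq_integral do rewrite mulr0; rewrite integral0.
Qed.


Lemma Rintegral_finite_measure_cst d (T : measurableType d) (R : realType)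
    (m : {finite_measure set T -> \bar R}) (c : R) :
  \int[m]_x c = c * fine (m setT).
Proof. exact: Rintegral_cst. Qed.

Lemma Rintegral_cos0 (R : realType)
    (m : finmeasure R) :
  \int[m]_x cos (0 * x) = fine (m setT).
Proof.
under eq_Rintegral do rewrite mul0r cos0.
by rewrite Rintegral_finite_measure_cst mul1r.
Qed.

Section fourier_uniqueness.
Variables (R : realType) (a b : finmeasure R).
Hypothesis abcos : forall t : R, \int[a]_x cos (t * x) = \int[b]_x cos (t * x).
Hypothesis absin : forall t : R, \int[a]_x sin (t * x) = \int[b]_x sin (t * x).

Let measurable_cosM (t : R) :
  measurable_fun setT (fun x : measurableTypeR R => cos (t * x)).
Proof.
apply: measurableT_comp; last exact: measurable_funM.
by apply: continuous_measurable_fun; exact: continuous_cos.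
Qed.

Let measurable_sinM (t : R) :
  measurable_fun setT (fun x : measurableTypeR R => sin (t * x)).
Proof.
apply: measurableT_comp; last exact: measurable_funM.
by apply: continuous_measurable_fun; exact: continuous_sin.
Qed.

Let ab_mass : fine (a setT) = fine (b setT).
Proof. by rewrite -!Rintegral_cos0 abcos. Qed.

Let ab_shifted_cos (k t y : R) :
  (\int[a]_x (k * (1 + cos (t * (x - y))))%:E =
   \int[b]_x (k * (1 + cos (t * (x - y))))%:E)%E.
Proof.
have E (m : finmeasure R) :
    (\int[m]_x (k * (1 + cos (t * (x - y))))%:E =
     (k * fine (m setT) + k * cos (t * y) * \int[m]_x cos (t * x) +
      k * sin (t * y) * \int[m]_x sin (t * x))%:E)%E.
  have ic : m.-integrable setT (EFin \o (fun x : R => cos (t * x))).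
    by apply: (@bounded_integrable _ _ _ _ _ _ 1) => // x _; exact: cos_max.
  have is_ : m.-integrable setT (EFin \o (fun x : R => sin (t * x))).
    by apply: (@bounded_integrable _ _ _ _ _ _ 1) => // x _; exact: sin_max.
  under eq_integral => x _.
    rewrite (_ : _ * _ = k + k * cos (t * y) * cos (t * x)
      + k * sin (t * y) * sin (t * x)); last first.
      by rewrite mulrBr cosB; ring.
    over.
  have i1 : m.-integrable setT (EFin \o (fun=> k)).
    exact: finite_measure_integrable_cst.
  have i2 : m.-integrable setT
      (EFin \o (fun x : R => k * cos (t * y) * cos (t * x))).
    exact: integrableZl ic.
  have i3 : m.-integrable setT
      (EFin \o (fun x : R => k * sin (t * y) * sin (t * x))).
    exact: integrableZl is_.
  have i12 : m.-integrable setT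
      (EFin \o (fun x : R => k + k * cos (t * y) * cos (t * x))).
    exact: integrableD i1 i2.
  rewrite -(RintegralZl _ _ ic)// -(RintegralZl _ _ is_)//.
  rewrite -Rintegral_finite_measure_cst -!RintegralD// /Rintegral fineK//.
  by apply: integrable_fin_num => //; exact: integrableD i12 i3.
by rewrite !E ab_mass abcos absin.
Qed.

Let ab_poisson (e y : R) : 0 < e ->
  (\int[a]_x (e^-1 + e / (e ^+ 2 + (x - y) ^+ 2))%:E =
   \int[b]_x (e^-1 + e / (e ^+ 2 + (x - y) ^+ 2))%:E)%E.
Proof.
move=> e0.
have E (m : finmeasure R) :
    (\int[m]_x (e^-1 + e / (e ^+ 2 + (x - y) ^+ 2))%:E =
     \int[@lebesgue_measure R]_(t in `[0%R, +oo[)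
       \int[m]_x (expR (- (e * t)) * (1 + cos (t * (x - y))))%:E)%E.
  under eq_integral do rewrite -laplace_1Dcos//.
  apply: (@tonelli_finite_lebesgue _ m _ (fun x t : R =>
    expR (- (e * t)) * (1 + cos (t * (x - y))))).
  - exact: measurable_itv.
  - apply: measurable_funM.
      apply: measurableT_comp => //; apply: measurableT_comp => //.
      exact: measurable_funM.
    apply: measurable_funD => //; apply: measurableT_comp.
      by apply: continuous_measurable_fun; exact: continuous_cos.
    by apply: measurable_funM => //; exact: measurable_funB.
  - move=> x t; rewrite mulr_ge0 ?expR_ge0//.
by rewrite !E; apply: eq_integral => t _; exact: ab_shifted_cos.
Qed.

Let measurable_atanM (e q : R) :
  measurable_fun setT (fun x : measurableTypeR R => atan ((q - x) / e)).
Proof.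
apply: measurableT_comp.
  by apply: continuous_measurable_fun; exact: continuous_atan.
by apply: measurable_funM => //; exact: measurable_funB.
Qed.

Let atan_lt2 (x : R) : `|atan x| <= pi.
Proof.
rewrite ler_norml; have := atan_ltpi2 x; have := atan_gtNpi2 x.
by have := pi_ge0 R; lra.
Qed.

Let ab_atan (e p q : R) : 0 < e -> p < q ->
  \int[a]_x (atan ((q - x) / e) - atan ((p - x) / e)) =
  \int[b]_x (atan ((q - x) / e) - atan ((p - x) / e)).
Proof.
move=> e0 pq.
have E (m : finmeasure R) :
    (\int[@lebesgue_measure R]_(y in `[p, q])
       \int[m]_x (e^-1 + e / (e ^+ 2 + (x - y) ^+ 2))%:E =
     ((q - p) / e * fine (m setT) +
      \int[m]_x (atan ((q - x) / e) - atan ((p - x) / e)))%:E)%E.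
  rewrite -(@tonelli_finite_lebesgue _ m _ (fun x y : R =>
    e^-1 + e / (e ^+ 2 + (x - y) ^+ 2))).
  - under eq_integral do rewrite poisson_atan//.
    have i1 : m.-integrable setT (EFin \o (fun=> (q - p) / e)).
      exact: finite_measure_integrable_cst.
    have i2 : m.-integrable setT
        (EFin \o (fun x : R => atan ((q - x) / e) - atan ((p - x) / e))).
      apply: (@bounded_integrable _ _ _ _ _ _ (pi + pi)) => //.
        exact: measurable_funB.
      by move=> x _; rewrite (le_trans (ler_normB _ _))// lerD.
    rewrite -Rintegral_finite_measure_cst -RintegralD// /Rintegral fineK//.
    by apply: integrable_fin_num => //; exact: integrableD i1 i2.
  - exact: measurable_itv.
  - apply: measurable_funD => //.
    have mh : measurable_fun setT
        (fun u : measurableTypeR R => e / (e ^+ 2 + u ^+ 2)).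
      apply: continuous_measurable_fun => u; apply: cvgMr; apply: cvgV.
        by rewrite gt_eqF// ltr_pwDl ?exprn_gt0 ?sqr_ge0.
      by apply: cvgD; [exact: cvg_cst|exact: exprn_continuous].
    apply: (measurableT_comp mh (f := _)
      (g := fun z : measurableTypeR R * measurableTypeR R => z.1 - z.2)).
    exact: measurable_funB.
  - move=> x y; rewrite addr_ge0 ?invr_ge0 ?divr_ge0 ?(ltW e0)//.
    by rewrite addr_ge0 ?sqr_ge0.
have := E a; under eq_integral do rewrite ab_poisson//.
by rewrite E ab_mass => -[] /addrI.
Qed.

(** Equality of the transforms gives equality of the integrals of the Poisson
   kernels, hence of differences of arctangents.  With suitable parameters the
   latter converge boundedly to pi times the indicator of ]-oo, x]. *)
Lemma finite_measure_fourier_uniq (x : R) :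
  a `]-oo, x]%classic = b `]-oo, x]%classic.
Proof.
(* the scale e n goes to 0 faster than q n goes to x, so that the arctangent
   centered at q n is asymptotically pi / 2 up to x included *)
pose q n : R := x + n.+1%:R^-1.
pose e n : R := (n.+1%:R^-1) ^+ 2.
pose p n : R := x - n%:R.
have e0 n : 0 < e n by rewrite exprn_gt0 ?invr_gt0.
have pq n : p n < q n.
  by rewrite ltrD2l (@le_lt_trans _ _ 0) ?oppr_le0 ?invr_gt0 ?ler0n.
pose f n (z : R) := atan ((q n - z) / e n) - atan ((p n - z) / e n).
pose f0 (z : R) : R := pi * \1_(`]-oo, x]%classic : set R) z.
have f_bound n z : `|f n z| <= pi + pi.
  by rewrite (le_trans (ler_normB _ _))// lerD ?atan_lt2.
have atanNy (u : nat -> R) : u n @[n --> \oo] --> -oo ->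
    atan (u n) @[n --> \oo] --> - (pi / 2).
  move=> /cvgNry uoo; under eq_fun do rewrite -[u _]opprK atanN.
  by apply: cvgN; exact: (cvg_comp _ _ uoo (@cvgy_atan R)).
have N1 n : 1 <= n.+1%:R :> R by rewrite ler1n.
have eE n (u : R) : u / e n = u * n.+1%:R ^+ 2 by rewrite /e exprVn invrK.
have zNy (z : R) : (p n - z) / e n @[n --> \oo] --> -oo.
  apply/cvgrNyPle => A; near=> n; rewrite eE.
  have nA : x - z + `|A| <= n%:R by near: n; exact: nbhs_infty_ger.
  have /ler_normlP[A1 A2] := lexx `|A|.
  have : 1 <= n.+1%:R ^+ 2 :> R by rewrite exprn_ege1.
  have A0 := normr_ge0 A; rewrite /p.
  by move: (_ ^+ 2) => S; nra.
have ff0 z : f n z @[n --> \oo] --> f0 z.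
  rewrite /f0 indicE; have [xz|zx] := ltP x z.
    rewrite memNset ?mulr0 /=; last by rewrite in_itv/= leNgt xz.
    rewrite -(subrr (- (pi / 2))); apply: cvgB; apply: atanNy => //.
    apply/cvgrNyPle => A; near=> n; rewrite eE /q.
    have nA : (1 + `|A|) / (z - x) <= n%:R by near: n; exact: nbhs_infty_ger.
    have {nA} : 1 + `|A| <= n.+1%:R * (z - x).
      rewrite -ler_pdivrMr ?subr_gt0// (le_trans nA)// ler_nat.
      exact: leqnSn.
    have /ler_normlP[A1 A2] := lexx `|A|.
    have := N1 n; set N := n.+1%:R => N1n NA.
    have -> : (x + N^-1 - z) * N ^+ 2 = N * (1 - N * (z - x)).
      by field; rewrite gt_eqF// (lt_le_trans ltr01).
    nra.
  rewrite mem_set ?mulr1 /=; last by rewrite in_itv.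
  rewrite (_ : pi = pi / 2 - - (pi / 2)); last by lra.
  apply: cvgB; last exact: atanNy.
  apply: (cvg_comp _ _ _ (@cvgy_atan R)).
  apply/cvgryPge => A; near=> n; rewrite eE /q.
  have nA : A <= n%:R by near: n; exact: nbhs_infty_ger.
  have := N1 n; have -> : n.+1%:R = n%:R + 1 :> R by rewrite -natr1.
  set N := n%:R + 1 => N1n.
  have -> : (x + N^-1 - z) * N ^+ 2 = N + (x - z) * N ^+ 2.
    by field; rewrite gt_eqF// (lt_le_trans ltr01).
  rewrite (@le_trans _ _ N)//; first by rewrite (le_trans nA)// lerDl.
  by rewrite lerDl mulr_ge0 ?subr_ge0 ?sqr_ge0.
have cvg_int (m : finmeasure R) :
    \int[m]_z f n z @[n --> \oo] --> pi * fine (m `]-oo, x]%classic).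
  rewrite (_ : pi * _ = \int[m]_z f0 z).
    apply: (@bounded_cvg_Rintegral _ _ _ _ _ _ _ (pi + pi)) => //.
    - exact: finite_measure_lty.
    - by move=> n; exact: measurable_funB.
    - exact: measurable_funM.
    - by apply: aeW => z _; exact: ff0.
  rewrite /f0 RintegralZl//; last first.
    apply: (@bounded_integrable _ _ _ _ _ _ 1) => // z _.
    by rewrite indicE ger0_norm// lern1 leq_b1.
  by rewrite /Rintegral integral_indic// setIT.
have := cvg_int b; under eq_fun do rewrite -ab_atan//.
move=> /(cvg_unique _ (cvg_int a)) /mulfI.
rewrite gt_eqF ?pi_gt0// => /(_ isT) ab.
have mI : measurable (`]-oo, x]%classic : set (measurableTypeR R)).
  exact: measurable_itv.
rewrite -(fineK (fin_num_measure a _ mI)) -(fineK (fin_num_measure b _ mI)).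
by congr (_%:E); exact: ab.
Unshelve. all: end_near. Qed.

End fourier_uniqueness.

(** * Helly's selection theorem *)

(** A countable set can be dodged by all the translates x_ i + theta of a
   sequence at once, with theta arbitrarily small: the bad theta form a
   countable, hence Lebesgue-negligible, set. *)
Lemma countable_avoid_shift (R : realType) (D : set R) (x_ : nat -> R) (d : R) :
  countable D -> 0 < d ->
  exists theta, 0 < theta < d /\ forall i, ~ D (x_ i + theta).
Proof.
move=> cD d0; apply: contrapT => H.
pose E : set R := \bigcup_i [set y - x_ i | y in D].
have cE : countable E.
  apply: bigcup_countable => // i _.
  exact: sub_countable (card_image_le _ _) cD.
have dE : `]0, d[ `<=` E.
  move=> t /=; rewrite in_itv/= => t0d; apply: contrapT => tE.
  apply: H; exists t; split => // i Dxt; apply: tE.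
  by exists i => //; exists (x_ i + t) => //; rewrite addrAC subrr add0r.
have mE : measurable (E : set (measurableTypeR R)).
  exact: countable_measurable.
have E0 : @lebesgue_measure R E = 0%E by exact: countable_lebesgue_measure0.
have I0 : @lebesgue_measure R `]0, d[%classic = d%:E.
  by rewrite lebesgue_measure_itv/= lte_fin d0 oppr0 adde0.
have : (d%:E <= 0)%E.
  by rewrite -I0 -E0; apply: le_measure => //; rewrite inE.
by rewrite lee_fin leNgt d0.
Qed.

(** Evaluation at a rational is continuous for the topology of pointwise
   convergence. *)
Lemma near_prod_coordinate (R : realType)
    (phi : rat_functions R) (q : rat) (e : R) :
  0 < e ->
  \forall f \near phi, `|(f : rat -> R) q - (phi : rat -> R) q| < e.
Proof.
move=> e0.
have pc := @proj_continuous rat (fun _ => R : topologicalType) q.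
have nb : nbhs ((phi : rat -> R) q) (ball ((phi : rat -> R) q) e).
  exact: nbhsx_ballx.
have H : nbhs phi ((@proj rat (fun _ => R : topologicalType) q) @^-1`
    (ball ((phi : rat -> R) q) e)) by exact: pc.
by refine (@filterS _ (nbhs phi) _ _ _ _ H) => f; rewrite /ball/= distrC.
Qed.

(** Only finitely many rationals have a code below m, so that the neighborhoods
   given by the previous lemma can be intersected. *)
Lemma near_prod_coordinates (R : realType)
    (phi : rat_functions R) (m : nat) (e : R) :
  0 < e ->
  \forall f \near phi, forall q, (choice.pickle q < m)%N ->
    `|(f : rat -> R) q - (phi : rat -> R) q| < e.
Proof.
move=> e0; elim: m => [|m IHm].
  exact: (@filterE _ (nbhs phi)).
have [[q0 qm]|qm] := pselect (exists q : rat, choice.pickle q = m).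
  refine (@filterS2 _ (nbhs phi) _ _ _ _ _
    (near_prod_coordinate phi q0 e0) IHm) => f fq0 fm q.
  rewrite ltnS leq_eqVlt => /predU1P[|]; last exact: fm.
  by rewrite -qm => /(pcan_inj choice.pickleK) ->.
refine (@filterS _ (nbhs phi) _ _ _ _ IHm) => f fm q.
rewrite ltnS leq_eqVlt => /predU1P[qm'|]; last exact: fm.
by exfalso; apply: qm; exists q.
Qed.

(** Tychonoff's theorem gives a cluster point phi in place of a diagonal
   extraction; the k-th term of the subsequence is then chosen close to phi at
   the first k rationals. *)
Lemma pointwise_subsequence (R : realType) (u : nat -> rat -> R) (C : R) :
  (forall n q, 0 <= u n q <= C) ->
  exists s : nat -> nat, {homo s : m n / (m < n)%N} /\
    exists phi : rat -> R, (forall q, 0 <= phi q <= C) /\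
      forall q, u (s k) q @[k --> \oo] --> phi q.
Proof.
move=> uC.
have [phi [phiC clphi]] : [set f : rat_functions R |
      forall i, `[0, C]%classic (f i)] `&`
    cluster ((u : nat -> rat_functions R) @ \oo) !=set0.
  apply: (@tychonoff rat (fun _ => R : topologicalType)
    (fun _ => `[0, C]%classic)).
    by move=> _; exact: segment_compact.
  by exists 0%N => // n _ q; rewrite /= in_itv/=; exact: uC.
have ex k N : exists n, (N <= n)%N /\
    forall q : rat, (choice.pickle q < k)%N -> `|u n q - phi q| < k.+1%:R^-1.
  have k0 : 0 < k.+1%:R^-1 :> R by rewrite invr_gt0.
  have near_u : (u @ \oo) [set u n | n in [set n | (N <= n)%N]].
    by exists N => // n Nn; exists n.
  have [f [[n Nn <-] un]] := clphi _ _ near_u (near_prod_coordinates phi k k0).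
  by exists n.
pose g k N := sval (cid (ex k N)).
have gN k N : (N <= g k N)%N by have [] := svalP (cid (ex k N)).
have gu k N : forall q : rat, (choice.pickle q < k)%N ->
    `|u (g k N) q - phi q| < k.+1%:R^-1.
  by have [] := svalP (cid (ex k N)).
pose s := fix s k := if k is k'.+1 then g k (s k').+1 else g 0%N 0%N.
exists s; split.
  by apply: homo_ltn => [|k]; [exact: ltn_trans|exact: gN].
exists phi; split.
  by move=> q; have := phiC q; rewrite /= in_itv.
move=> q; apply/cvgrPdist_lt => e e0; near=> k.
rewrite distrC (@lt_trans _ _ k.+1%:R^-1)//.
  have : (choice.pickle q < k)%N by near: k; exact: nbhs_infty_gt.
  have skE j : exists N, s j = g j N.
    by case: j => [|j]; [exists 0%N|exists (s j).+1].
  by have [N ->] := skE k; exact: gu.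
rewrite invf_plt ?posrE// (@le_lt_trans _ _ k%:R) ?ltr_nat//.
by near: k; exact: nbhs_infty_ger.
Unshelve. all: end_near. Qed.

Lemma nondecreasing_at_left_cvg (R : realType) (F : R -> R) (x : R) :
  nondecreasing F -> F y @[y --> x^'-] --> sup [set F y | y in [set y | y < x]].
Proof.
move=> Fnd; set S := [set F y | y in _].
have supS : has_sup S.
  split; first by exists (F (x - 1)), (x - 1) => //=; rewrite ltrBlDr ltrDl.
  by exists (F x) => _ [y /= yx <-]; apply: Fnd; exact: ltW.
apply/cvgrPdist_lt => e e0.
have [_ [z /= zx <-] Fz] := sup_adherent e0 supS.
near=> y.
have Sy : F y <= sup S.
  by apply: (sup_upper_bound supS); exists y => //=; near: y; exact: nbhs_left_lt.
rewrite ger0_norm ?subr_ge0// ltrBlDr -ltrBlDl (lt_le_trans Fz)//.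
by apply: Fnd; near: y; exact: nbhs_left_ge.
Unshelve. all: end_near. Qed.

(** For a right-continuous monotone function the only defect of continuity is a
   jump from the left. *)
Lemma right_continuous_not_discontinuity (R : realType) (F : R -> R) (x : R) :
  nondecreasing F -> right_continuous F -> ~ discontinuity F x ->
  F y @[y --> x^'-] --> F x.
Proof.
move=> Fnd Frc dF; have Fl := nondecreasing_at_left_cvg (x := x) Fnd.
have Fr := Frc x.
have [E|E] := eqVneq (sup [set F y | y in [set y | y < x]]) (F x).
  by rewrite -E.
exfalso; apply: dF; split.
- by apply/cvg_ex; eexists; exact: Fl.
- by apply/cvg_ex; eexists; exact: Fr.
- by rewrite (cvg_lim _ Fl)// (cvg_lim _ Fr).
Qed.

Lemma discontinuity_countableT (R : realType) (F : R -> R) :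
  nondecreasing F -> countable [set x | discontinuity F x].
Proof.
move=> Fnd.
apply: (@sub_countable _ _ _ (\bigcup_n
    [set x | x \in (`]- n%:R, n%:R[) /\ discontinuity F x])); last first.
  apply: bigcup_countable => // n _; apply: discontinuity_countable.
  by move=> x y _ _; exact: Fnd.
apply: subset_card_le => x /= dx.
exists (Num.truncn `|x|).+1 => //=; split => //.
by rewrite in_itv/= -ltr_norml truncnS_gt.
Qed.

(** After convergence to phi at the rationals, F is the right-continuous
   regularization of phi.  At a point x where F does not jump, the monotone
   functions F_ (s k) are squeezed at x between their values at rationals on
   both sides of x, where phi is close to F x. *)
Lemma helly_selection (R : realType) (F_ : nat -> R -> R) (C : R) :
  (forall n, nondecreasing (F_ n)) -> (forall n x, 0 <= F_ n x <= C) ->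
  exists s : nat -> nat, {homo s : m n / (m < n)%N} /\
  exists F : R -> R, [/\ nondecreasing F, right_continuous F,
    (forall x, 0 <= F x <= C) &
    forall x, ~ discontinuity F x -> F_ (s k) x @[k --> \oo] --> F x].
Proof.
move=> Fnd FC.
have [s [sinc [phi [phiC uphi]]]] :=
  @pointwise_subsequence R (fun n q => F_ n (ratr q)) C (fun n q => FC n _).
exists s; split => //.
have phind (p q : rat) : p <= q -> phi p <= phi q.
  move=> pq; apply: (ler_cvg_to (uphi p) (uphi q)); near=> k.
  by apply: Fnd; rewrite ler_rat.
pose S (x : R) := [set phi q | q in [set q : rat | x < ratr q]].
have S0 x : S x !=set0.
  have xx1 : x < x + 1 by rewrite ltrDl.
  have [q] := rat_in_itvoo xx1; rewrite in_itv/= => /andP[xq _].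
  by exists (phi q), q.
have Slb x : has_lbound (S x).
  by exists 0 => _ [q _ <-]; have /andP[] := phiC q.
pose F x := inf (S x).
have Fphi x (q : rat) : x < ratr q -> F x <= phi q.
  by move=> xq; apply: ge_inf => //; exists q.
have Fadh x (e : R) : 0 < e -> exists2 q : rat, x < ratr q & phi q < F x + e.
  move=> e0; have [_ [q xq <-] qe] := inf_adherent e0 (conj (S0 x) (Slb x)).
  by exists q.
have phiF x (q : rat) : ratr q <= x -> phi q <= F x.
  move=> qx; apply: lb_le_inf => // _ [p /= xp <-].
  by apply: phind; rewrite -(ler_rat R); apply: ltW; exact: le_lt_trans xp.
have Fnd' : nondecreasing F.
  move=> x y xy; apply: lb_le_inf => // _ [q /= yq <-].
  by apply: Fphi; exact: le_lt_trans yq.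
have Frc : right_continuous F.
  move=> x; apply/cvgrPdist_le => e e0.
  have [q xq qe] := Fadh x e e0; near=> y.
  have xy : x <= y by near: y; exact: nbhs_right_ge.
  rewrite distrC ger0_norm ?subr_ge0 ?Fnd'// lerBlDl (le_trans _ (ltW qe))//.
  by apply: Fphi; near: y; exact: nbhs_right_lt.
exists F; split => //.
- move=> x; apply/andP; split.
    by apply: lb_le_inf => // _ [q _ <-]; have /andP[] := phiC q.
  have [_ [q xq _]] := S0 x; apply: (le_trans (Fphi _ _ xq)).
  by have /andP[] := phiC q.
move=> x dx; have Flc := right_continuous_not_discontinuity Fnd' Frc dx.
apply/cvgrPdist_le => e e0; have e20 : 0 < e / 2 by rewrite divr_gt0.
have [q xq qe] := Fadh x _ e20.
have [y [yx Fy]] : exists y, y < x /\ F x - e / 2 <= F y.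
  have /cvgrPdist_le /(_ _ e20) Fe := Flc.
  near x^'- => y; exists y; split; first by near: y; exact: nbhs_left_lt.
  rewrite lerBlDr -lerBlDl; apply: (le_trans (ler_norm _)).
  by near: y.
have [r] := rat_in_itvoo yx; rewrite in_itv/= => /andP[yr rx].
have phir : F x - e / 2 <= phi r by rewrite (le_trans Fy)// Fphi.
have /cvgrPdist_le /(_ _ e20) uq := uphi q.
have /cvgrPdist_le /(_ _ e20) ur := uphi r.
near=> k.
have qk : `|phi q - F_ (s k) (ratr q)| <= e / 2.
  by near: k.
have rk : `|phi r - F_ (s k) (ratr r)| <= e / 2.
  by near: k.
have := Fnd (s k) _ _ (ltW xq); have := Fnd (s k) _ _ (ltW rx).
move: qk rk; rewrite !ler_norml => /andP[q1 q2] /andP[r1 r2].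
by move=> H1 H2; apply/andP; split; lra.
Unshelve. all: end_near. Qed.

(** * Vague convergence of finite measures *)

Lemma lipschitz_continuous (R : realType) (h : R -> R) (K : R) :
  (forall x y, `|h x - h y| <= K * `|x - y|) -> continuous h.
Proof.
move=> hK x; have K0 : 0 <= K.
  by have := hK 1 0; rewrite subr0 normr1 mulr1; exact: le_trans.
apply/cvgrPdist_le => e e0.
have K1 : 0 < K + 1 by rewrite ltr_wpDl.
have eK : 0 < e / (K + 1) by rewrite divr_gt0.
have /cvgrPdist_le /(_ _ eK) xe : y @[y --> x] --> x by exact: cvg_id.
near=> y.
rewrite (le_trans (hK x y))// (@le_trans _ _ ((K + 1) * `|x - y|))//.
  by rewrite ler_wpM2r// lerDl.
by rewrite mulrC -ler_pdivlMr//; near: y.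
Unshelve. all: end_near. Qed.

Lemma cvg_sum_ord (R : realType) (f : nat -> nat -> R) (l : nat -> R) (N : nat) :
  (forall k, f k n @[n --> \oo] --> l k) ->
  \sum_(k < N) f k n @[n --> \oo] --> \sum_(k < N) l k.
Proof.
move=> fl; elim: N => [|N IH].
  by under eq_fun do rewrite big_ord0; rewrite big_ord0; exact: cvg_cst.
under eq_fun do rewrite big_ord_recr/=.
by rewrite big_ord_recr/=; exact: cvgD.
Qed.

(** The value at the right end point is used on each interval ]x_ k, x_ k.+1],
   so that the integral is a combination of masses of half-open intervals. *)
Definition step_approx (R : realType) (h : R -> R) (x_ : nat -> R) (N : nat)
    (y : R) : R :=
  \sum_(k < N) h (x_ k.+1) * \1_(`]x_ k, x_ k.+1]%classic : set R) y.

Lemma step_approx0 (R : realType) (h : R -> R) (x_ : nat -> R) :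
  step_approx h x_ 0 = cst 0.
Proof. by apply/funext => y; rewrite /step_approx big_ord0. Qed.

Lemma step_approxS (R : realType) (h : R -> R) (x_ : nat -> R) (N : nat) :
  step_approx h x_ N.+1 = fun y => step_approx h x_ N y +
    h (x_ N.+1) * \1_(`]x_ N, x_ N.+1]%classic : set R) y.
Proof. by apply/funext => y; rewrite /step_approx big_ord_recr. Qed.

Lemma step_approx_near (R : realType) (h : R -> R) (x_ : nat -> R) (N : nat)
    (d e : R) :
  (forall k, x_ k < x_ k.+1) ->
  (forall k y, x_ k < y <= x_ k.+1 -> `|h y - h (x_ k.+1)| <= d) ->
  (forall y, y <= x_ 0%N \/ x_ N < y -> `|h y| <= e) -> d <= e ->
  forall y, `|h y - step_approx h x_ N y| <= e.
Proof.
move=> xS hd he de y.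
have xmono k : x_ 0%N <= x_ k.
  by elim: k => // k IH; rewrite (le_trans IH)// ltW.
have H n : (y <= x_ 0%N \/ x_ n < y -> step_approx h x_ n y = 0) /\
    (x_ 0%N < y <= x_ n -> `|h y - step_approx h x_ n y| <= d).
  elim: n => [|n [IH1 IH2]].
    split=> [_|/andP[xy yx]]; first by rewrite /step_approx big_ord0.
    by move: xy; rewrite ltNge yx.
  rewrite step_approxS indicE; split.
    move=> yx; rewrite IH1; last first.
      by case: yx => [|/(lt_trans (xS n))]; [left|right].
    rewrite memNset ?mulr0 ?addr0//= in_itv/=.
    case: yx => [yx|yx]; first by rewrite ltNge (le_trans yx).
    by rewrite (leNgt y) yx andbF.
  move=> /andP[xy yx]; have [yn|ny] := leP y (x_ n).
    rewrite memNset ?mulr0 ?addr0 ?IH2 ?xy//= in_itv/= ltNge yn.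
    by case.
  rewrite IH1; last by right.
  by rewrite add0r mem_set ?mulr1 ?hd//= ?in_itv/= ?ny.
have [H1 H2] := H N.
have [/andP xy|] := boolP (x_ 0%N < y <= x_ N).
  by rewrite (le_trans _ de)// H2//; exact/andP.
move=> /negP xy; have oy : y <= x_ 0%N \/ x_ N < y.
  have [|xy0] := leP y (x_ 0%N); first by left.
  by right; rewrite ltNge; apply/negP => yN; apply: xy; rewrite xy0.
by rewrite (H1 oy) subr0 he.
Qed.

Lemma measurable_step_approx (R : realType) (h : R -> R) (x_ : nat -> R) (N : nat) :
  measurable_fun [set: measurableTypeR R] (step_approx h x_ N).
Proof.
elim: N => [|N IH].
  by rewrite step_approx0.
by rewrite step_approxS; apply: measurable_funD => //; exact: measurable_funM.
Qed.

Lemma step_approx_bound (R : realType) (h : R -> R) (x_ : nat -> R) (N : nat) y :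
  `|step_approx h x_ N y| <= \sum_(k < N) `|h (x_ k.+1)|.
Proof.
rewrite (le_trans (ler_norm_sum _ _ _))//; apply: ler_sum => k _.
rewrite normrM ler_piMr// indicE ger0_norm ?ler0n//.
by rewrite lern1 leq_b1.
Qed.

Lemma Rintegral_step_approx (R : realType)
    (m : finmeasure R)
    (h : R -> R) (x_ : nat -> R) (N : nat) :
  \int[m]_y step_approx h x_ N y =
  \sum_(k < N) h (x_ k.+1) * fine (m `]x_ k, x_ k.+1]%classic).
Proof.
elim: N => [|N IH].
  by rewrite big_ord0 step_approx0 (Rintegral_cst m measurableT) mul0r.
have mI : measurable (`]x_ N, x_ N.+1]%classic : set (measurableTypeR R)).
  exact: measurable_itv.
have iI : m.-integrable setT
    (EFin \o (fun y => \1_(`]x_ N, x_ N.+1]%classic : set R) y)).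
  apply: (@bounded_integrable _ _ _ _ _ _ 1) => //.
    exact: measurable_indic.
  by move=> y _; rewrite indicE ger0_norm// lern1 leq_b1.
rewrite big_ord_recr/= step_approxS RintegralD//.
- rewrite IH RintegralZl//; congr (_ + _ * _).
  by rewrite /Rintegral integral_indic// setIT.
- apply: (@bounded_integrable _ _ _ _ _ _ (\sum_(k < N) `|h (x_ k.+1)|)) => //.
    exact: measurable_step_approx.
  by move=> y _; exact: step_approx_bound.
- exact: integrableZl iI.
Qed.

Lemma Rintegral_dist_le (R : realType)
    (m : finmeasure R)
    (f g : R -> R) (e C : R) :
  measurable_fun [set: measurableTypeR R] f ->
  measurable_fun [set: measurableTypeR R] g ->
  (forall y, `|g y| <= C) ->
  (forall y, `|f y - g y| <= e) ->
  `|\int[m]_y f y - \int[m]_y g y| <= e * fine (m setT).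
Proof.
move=> mf mg gC fge.
have ig : m.-integrable setT (EFin \o g).
  by apply: (@bounded_integrable _ _ _ _ _ _ C) => // y _.
have iif : m.-integrable setT (EFin \o f).
  apply: (@bounded_integrable _ _ _ _ _ _ (e + C)) => // y _.
  by rewrite -[X in `|X|](subrK (g y)) (le_trans (ler_normD _ _))// lerD.
have ifg : m.-integrable setT (EFin \o (fun y => f y - g y)).
  apply: (@bounded_integrable _ _ _ _ _ _ e) => //.
  exact: measurable_funB.
rewrite -RintegralB// (le_trans (le_normr_Rintegral _ ifg))//.
rewrite -(Rintegral_cst m measurableT e); apply: le_Rintegral => //.
- exact: integrable_norm.
- exact: finite_measure_integrable_cst.
Qed.

(** The integrand is uniformly approximated by step functions on a grid
   avoiding D: it is Lipschitz, hence nearly constant on the cells of a fine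
   grid, and small outside a large interval. *)
Lemma vague_cvg_Rintegral (R : realType)
    (a_ : nat -> finmeasure R)
    (a : finmeasure R)
    (D : set R) (h : R -> R) (C K L : R) :
  countable D -> (forall n, fine (a_ n setT) <= C) -> fine (a setT) <= C ->
  (forall x y, x < y -> ~ D x -> ~ D y ->
    fine (a_ n `]x, y]%classic) @[n --> \oo] --> fine (a `]x, y]%classic)) ->
  (forall x y, `|h x - h y| <= K * `|x - y|) ->
  (forall x, `|h x| * `|x| <= L) ->
  \int[a_ n]_y h y @[n --> \oo] --> \int[a]_y h y.
Proof.
move=> cD aC0 aC aa hK hL; have ch := lipschitz_continuous hK.
have K0 : 0 <= K.
  by have := hK 1 0; rewrite subr0 normr1 mulr1; exact: le_trans.
have L0 : 0 <= L by have := hL 0; rewrite normr0 mulr0.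
have C0 : 0 <= C by rewrite (le_trans _ aC)// fine_ge0.
apply/cvgrPdist_le => e e0.
pose d := e / (3 * (C + 1)).
have d0 : 0 < d by rewrite divr_gt0// mulr_gt0// ltr_wpDl.
pose eta := d / (K + 1).
have eta0 : 0 < eta by rewrite divr_gt0// ltr_wpDl.
pose A := (L + 1) / d + 1.
(* a translate of the grid -A + eta * nat that avoids D; as it starts before
   1 - A, beyond its ends |y| is at least (L + 1) / d, where |h y| <= d *)
have [theta [/andP[t0 t1] xD]] :=
  @countable_avoid_shift R D (fun i => - A + i%:R * eta) 1 cD ltr01.
pose x_ i : R := - A + i%:R * eta + theta.
pose N := (Num.truncn (2 * A / eta)).+1.
have xN : A < x_ N.
  have : 2 * A / eta < N%:R by rewrite truncnS_gt.
  by rewrite ltr_pdivrMr// /x_; lra.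
have xS k : x_ k < x_ k.+1.
  by rewrite /x_ ltrD2r ltrD2l -natr1 mulrDl mul1r ltrDl.
have hd y : (L + 1) / d <= `|y| -> `|h y| <= d.
  move=> Ly; have y0 : 0 < `|y|.
    by rewrite (lt_le_trans _ Ly)// divr_gt0// ltr_wpDl.
  rewrite -(ler_pM2r y0) (le_trans (hL y))//.
  by move: Ly; rewrite ler_pdivrMr// mulrC; lra.
have approx y : `|h y - step_approx h x_ N y| <= d.
  apply: (@step_approx_near _ _ _ _ d d) => //.
    move=> k z /andP[xz zx]; rewrite (le_trans (hK _ _))//.
    rewrite ler0_norm ?subr_le0//.
    have xk : x_ k.+1 - x_ k = eta.
      by rewrite /x_ -natr1; ring.
    have : (K + 1) * eta = d by rewrite /eta mulrC divfK// gt_eqF// ltr_wpDl.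
    nra.
  move=> z zx; apply: hd; case: zx => zx.
    by rewrite ler_normr; apply/orP; right; move: zx; rewrite /x_ /A; lra.
  by rewrite ler_normr; apply/orP; left; move: xN zx; rewrite /A; lra.
have dC : d * C <= e / 3.
  have : d * (C + 1) = e / 3 by rewrite /d; field; rewrite gt_eqF// ltr_wpDl.
  by rewrite mulrDr; lra.
have dist (m : finmeasure R) :
    fine (m setT) <= C ->
    `|\int[m]_y h y - \int[m]_y step_approx h x_ N y| <= e / 3.
  move=> mC; apply: le_trans dC.
  apply: (le_trans (@Rintegral_dist_le _ m h (step_approx h x_ N) d
    (\sum_(k < N) `|h (x_ k.+1)|) _ _ _ approx)).
  - exact: continuous_measurable_fun.
  - exact: measurable_step_approx.
  - exact: step_approx_bound.
  - by rewrite ler_wpM2l// ltW.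
have scvg : \int[a_ n]_y step_approx h x_ N y @[n --> \oo] -->
    \int[a]_y step_approx h x_ N y.
  under eq_fun do rewrite Rintegral_step_approx.
  rewrite Rintegral_step_approx; apply: (@cvg_sum_ord R (fun k n =>
    h (x_ k.+1) * fine (a_ n `]x_ k, x_ k.+1]%classic))
    (fun k => h (x_ k.+1) * fine (a `]x_ k, x_ k.+1]%classic))) => k.
  by apply: cvgMr; apply: aa => //; exact: xD.
have e30 : 0 < e / 3 by rewrite divr_gt0.
have /cvgrPdist_le /(_ _ e30) scvg' := scvg.
near=> n.
have H1 := dist a aC; have H2 := dist (a_ n) (aC0 n).
have H3 : `|\int[a]_y step_approx h x_ N y -
    \int[a_ n]_y step_approx h x_ N y| <= e / 3 by near: n.
move: H1 H2 H3; rewrite !ler_norml; lra.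
Unshelve. all: end_near. Qed.

(** * Transforms averaged over a segment *)

(** The indefinite integral is constant, and at each Lebesgue point of u it is
   differentiable with derivative the value of u. *)
Lemma ae_eq0_itv (R : realType) (u : R -> R) (C : R) :
  measurable_fun [set: measurableTypeR R] u -> (forall x, `|u x| <= C) ->
  (forall p q, p < q -> \int[@lebesgue_measure R]_(t in `[p, q]) u t = 0) ->
  {ae @lebesgue_measure R, forall t, u t = 0}.
Proof.
move=> mu uC u0.
have iu p q : (@lebesgue_measure R).-integrable `[p, q] (EFin \o u).
  apply: (@bounded_integrable_lty _ _ _ _ _ _ C) => //.
  - by rewrite /= lebesgue_measure_itv/=; case: ifPn => _; rewrite ?ltry// -EFinB ltry.
  - exact: measurable_funTS.
have locu : locally_integrable setT u.
  split; [exact: mu|exact: openT|] => K _ cK.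
  have iK : (@lebesgue_measure R).-integrable K (EFin \o u).
    apply: (@bounded_integrable_lty _ _ _ _ _ _ C) => //.
    - exact: compact_measurable.
    - exact: compact_finite_measure.
    - exact: measurable_funTS.
  by case/integrableP : iK.
suff key (x : R) : lebesgue_pt u x -> u x = 0.
  exact: (@filterS _ _ (ae_filter_ringOfSetsType (@lebesgue_measure R)) _ _
    key (lebesgue_differentiation locu)).
move=> xu; have xx1 : x < x + 1 by rewrite ltrDl.
have [|_ <-] := @FTC1_lebesgue_pt R u (BLeft (x - 1)) x (x + 1) xx1 (iu _ _) _ xu.
  by rewrite /= lte_fin ltrBlDr.
rewrite (_ : (fun y => _) = cst 0) ?derive1_cst//.
apply/funext => y; have [|] := ltP (x - 1) y; first exact: u0.
rewrite le_eqVlt => /predU1P[->|yx]; first by rewrite set_itv1 Rintegral_set1.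
by rewrite set_itv_ge ?Rintegral_set0// bnd_simp -ltNge.
Qed.

(** The kernels of interest are w = cos and w = sin, with antiderivative W. *)
Section test_function.
Variables (R : realType) (w W : R -> R).
Hypothesis w_bound : forall u, `|w u| <= 1.
Hypothesis w_lip : forall u v, `|w u - w v| <= `|u - v|.
Hypothesis W_bound : forall u, `|W u| <= 1.
Hypothesis dW : forall u : R, is_derive u (1 : R) W (w u).

Let w_cont : continuous w.
Proof.
by apply: (@lipschitz_continuous _ _ 1) => x y; rewrite mul1r; exact: w_lip.
Qed.

Let measurable_wM (x : R) :
  measurable_fun setT (fun t : measurableTypeR R => w (t * x)).
Proof.
apply: measurableT_comp; last exact: measurable_funM.
exact: continuous_measurable_fun.
Qed.

Variables p q : R.
Hypothesis pq : p < q.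

(** The Fourier transform of the indicator of the segment [p, q]: unlike the
   kernel itself, it vanishes at infinity, and is thus an admissible test
   function for vague convergence. *)
Definition segment_transform (x : R) : R :=
  \int[@lebesgue_measure R]_(t in `[p, q]) w (t * x).

Let pq_lty : (@lebesgue_measure R `[p, q]%classic < +oo)%E.
Proof. by rewrite lebesgue_measure_itv/= lte_fin pq -EFinB ltry. Qed.

Let iw x : (@lebesgue_measure R).-integrable `[p, q]
  (EFin \o (fun t => w (t * x))).
Proof.
apply: (@bounded_integrable_lty _ _ _ _ _ _ 1) => //.
exact: measurable_funTS.
Qed.

(** Since W (t * x) has derivative x * w (t * x) in t, the product of x and the
   transform is a difference of two values of W. *)
Lemma segment_transform_decay x : `|segment_transform x| * `|x| <= 2.
Proof.
have dWx (t : R) : is_derive t (1 : R) (fun t => W (t * x)) (x * w (t * x)).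
  have := dW (t * x) => ?; apply: is_derive_eq.
  by rewrite /GRing.scale/=; ring.
have cw : continuous (fun t : R => x * w (t * x)).
  move=> t; apply: cvgMr; apply: continuous_comp; last exact: w_cont.
  exact: mulrr_continuous.
have E := is_derive_FTC2 pq cw dWx.
rewrite -normrM mulrC /segment_transform -RintegralZl// /Rintegral E/=.
by rewrite (le_trans (ler_normB _ _))// -[2]/(1 + 1) lerD.
Qed.

Lemma segment_transform_lip x y :
  `|segment_transform x - segment_transform y| <=
  (`|p| + `|q|) * (q - p) * `|x - y|.
Proof.
rewrite /segment_transform -RintegralB//.
have iB : (@lebesgue_measure R).-integrable `[p, q]
    (EFin \o (fun t => w (t * x) - w (t * y))).
  exact: integrableB (iw x) (iw y).
rewrite (le_trans (le_normr_Rintegral _ iB))//.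
have -> : (`|p| + `|q|) * (q - p) * `|x - y| =
    \int[@lebesgue_measure R]_(t in `[p, q]) ((`|p| + `|q|) * `|x - y|).
  rewrite Rintegral_cst// /= lebesgue_measure_itv/= lte_fin pq/=.
  by ring.
apply: le_Rintegral => //.
- exact: integrable_norm.
- by apply: (@bounded_integrable_lty _ _ _ _ _ _ `|(`|p| + `|q|) * `|x - y| |).
move=> t /=; rewrite in_itv/= => /andP[pt tq].
rewrite (le_trans (w_lip _ _))// -mulrBr normrM ler_wpM2r// ler_norml.
have /ler_normlP[? ?] := lexx `|p|; have /ler_normlP[? ?] := lexx `|q|.
by have := normr_ge0 p; have := normr_ge0 q; lra.
Qed.

Variable a : finmeasure R.

Lemma measure_transform_continuous : continuous (fun t : R => \int[a]_x w (t * x)).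
Proof.
move=> t.
have tI : t \in (`]t - 1, t + 1[%classic : set R).
  by rewrite inE/= in_itv/=; apply/andP; split; [rewrite ltrBlDr|]; rewrite ltrDl.
apply: (@continuity_under_integral R _ _ a (fun t x => w (t * x)) setT _
  (t - 1) (t + 1) _ _ (cst 1)) tI => //.
- move=> s _; apply: (@bounded_integrable _ _ _ _ _ _ 1) => //.
  apply: measurableT_comp; last exact: measurable_funM.
  exact: continuous_measurable_fun.
- apply: aeW => x _ s _; apply: continuous_comp; last exact: w_cont.
  exact: mulrr_continuous.
- exact: finite_measure_integrable_cst.
- by move=> s _; apply: aeW => x _; exact: w_bound.
Qed.

Lemma measure_transform_bound t : `|\int[a]_x w (t * x)| <= fine (a setT).
Proof.
have i1 : a.-integrable setT (EFin \o (fun x => w (t * x))).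
  apply: (@bounded_integrable _ _ _ _ _ _ 1) => //.
  apply: measurableT_comp; last exact: measurable_funM.
  exact: continuous_measurable_fun.
rewrite (le_trans (le_normr_Rintegral _ i1))//.
rewrite -[leRHS]mul1r -(Rintegral_cst a measurableT 1); apply: le_Rintegral => //.
- exact: integrable_norm.
- exact: finite_measure_integrable_cst.
Qed.

(** Fubini, reduced to Tonelli by the non-negativity of 1 + w. *)
Lemma segment_transform_fubini :
  \int[@lebesgue_measure R]_(t in `[p, q]) (\int[a]_x w (t * x)) =
  \int[a]_x segment_transform x.
Proof.
have mI : measurable (`[p, q]%classic : set (measurableTypeR R)).
  exact: measurable_itv.
have mpq : fine (@lebesgue_measure R `[p, q]%classic) = q - p.
  by rewrite lebesgue_measure_itv/= lte_fin pq.
have := @tonelli_finite_lebesgue R a `[p, q]%classic (fun x t => 1 + w (t * x)) mI.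
have mf : measurable_fun setT
    (fun z : measurableTypeR R * measurableTypeR R => 1 + w (z.2 * z.1)).
  apply: measurable_funD => //; apply: measurableT_comp.
    exact: continuous_measurable_fun.
  exact: measurable_funM.
have f0 x t : 0 <= 1 + w (t * x).
  by have := w_bound (t * x); rewrite ler_norml; lra.
move=> /(_ mf f0).
under eq_integral => x _.
  have -> : (\int[@lebesgue_measure R]_(t in `[p, q]) (1 + w (t * x))%:E =
      ((q - p) + segment_transform x)%:E)%E.
    have i1 : (@lebesgue_measure R).-integrable `[p, q] (EFin \o (fun=> 1)).
      apply: (@bounded_integrable_lty _ _ _ _ _ _ 1) => // y _.
      by rewrite normr1.
    rewrite -mpq -[X in X + _]mul1r -(Rintegral_cst _ mI 1).
    rewrite -RintegralD// /Rintegral fineK//.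
    by apply: integrable_fin_num => //; exact: integrableD i1 (iw x).
  over.
under [X in _ = X -> _]eq_integral => t _.
  have -> : (\int[a]_x (1 + w (t * x))%:E =
      (fine (a setT) + \int[a]_x w (t * x))%:E)%E.
    have i1 : a.-integrable setT (EFin \o (fun=> 1)).
      exact: finite_measure_integrable_cst.
    have i2 : a.-integrable setT (EFin \o (fun x => w (t * x))).
      apply: (@bounded_integrable _ _ _ _ _ _ 1) => //.
      apply: measurableT_comp; last exact: measurable_funM.
      exact: continuous_measurable_fun.
    rewrite -[X in X + _]mul1r -(Rintegral_cst a measurableT 1).
    rewrite -RintegralD// /Rintegral fineK//.
    by apply: integrable_fin_num => //; exact: integrableD i1 i2.
  over.
move=> /(congr1 fine).
have ST_cont : continuous segment_transform.
  by apply: lipschitz_continuous; exact: segment_transform_lip.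
have ST_bound x : `|segment_transform x| <= q - p.
  rewrite (le_trans (le_normr_Rintegral _ (iw x)))//.
  rewrite -mpq -[leRHS]mul1r -(Rintegral_cst _ mI 1); apply: le_Rintegral => //.
  - exact: integrable_norm.
  - apply: (@bounded_integrable_lty _ _ _ _ _ _ 1) => // y _.
    by rewrite normr1.
have i1 : a.-integrable setT (EFin \o (fun=> q - p)).
  exact: finite_measure_integrable_cst.
have i2 : a.-integrable setT (EFin \o segment_transform).
  apply: (@bounded_integrable _ _ _ _ _ _ (q - p)) => //.
  exact: continuous_measurable_fun.
have j1 : (@lebesgue_measure R).-integrable `[p, q] (EFin \o (fun=> fine (a setT))).
  apply: (@bounded_integrable_lty _ _ _ _ _ _ `|fine (a setT)|) => //.
have j2 : (@lebesgue_measure R).-integrable `[p, q]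
    (EFin \o (fun t => \int[a]_x w (t * x))).
  apply: (@bounded_integrable_lty _ _ _ _ _ _ (fine (a setT))) => //.
    apply: measurable_funTS; apply: continuous_measurable_fun.
    exact: measure_transform_continuous.
  by move=> t _; exact: measure_transform_bound.
have lhsE : \int[a]_x (q - p + segment_transform x) =
    (q - p) * fine (a setT) + \int[a]_x segment_transform x.
  by rewrite -(Rintegral_cst a measurableT) -RintegralD.
have rhsE : \int[@lebesgue_measure R]_(t in `[p, q])
      (fine (a setT) + \int[a]_x w (t * x)) =
    fine (a setT) * (q - p) +
    \int[@lebesgue_measure R]_(t in `[p, q]) \int[a]_x w (t * x).
  by rewrite -mpq -(Rintegral_cst _ mI) -RintegralD.
move=> E; have {E} : \int[a]_x (q - p + segment_transform x) =
    \int[@lebesgue_measure R]_(t in `[p, q])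
      (fine (a setT) + \int[a]_x w (t * x)) by exact: E.
by rewrite lhsE rhsE mulrC => /addrI ->.
Qed.

End test_function.

(** * Identification of the limit of the transforms *)

(** Two limits of the same integrals over segments agree.  As gamma need not be
   measurable, the upper limit of the sequence stands for it; clipping keeps
   this upper limit bounded where the sequence does not converge. *)
Lemma ae_limit_eq (R : realType) (c_ : nat -> R -> R) (c gamma : R -> R) (C : R) :
  (forall n, continuous (c_ n)) -> continuous c ->
  (forall n t, `|c_ n t| <= C) -> (forall t, `|c t| <= C) ->
  {ae @lebesgue_measure R, forall t, c_ n t @[n --> \oo] --> gamma t} ->
  (forall p q, p < q ->
    \int[@lebesgue_measure R]_(t in `[p, q]) c_ n t @[n --> \oo] -->
    \int[@lebesgue_measure R]_(t in `[p, q]) c t) ->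
  {ae @lebesgue_measure R, forall t, gamma t = c t}.
Proof.
move=> cc_ cc c_C cC cg intc.
pose u (t : R) :=
  Num.max (- C) (Num.min C (fine (limn_esup (fun n => (c_ n t)%:E)))).
have uE t : c_ n t @[n --> \oo] --> gamma t -> u t = gamma t.
  move=> ct.
  have gC : `|gamma t| <= C.
    by apply: (ler_cvg_to (cvg_norm ct) (@cvg_cst _ C _ _ _)); near=> n.
  have -> : u t = Num.max (- C) (Num.min C (gamma t)).
    rewrite /u; congr (Num.max _ (Num.min _ _)).
    have ctE : (c_ n t)%:E @[n --> \oo] --> (gamma t)%:E.
      by apply: cvg_EFin => //; near=> n.
    by rewrite is_cvg_limn_esupE;
      [rewrite (cvg_lim _ ctE)|apply/cvg_ex; exists (gamma t)%:E].
  move: gC; rewrite ler_norml => /andP[g1 g2].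
  by rewrite (min_idPr g2) (max_idPr g1).
have uC t : `|u t| <= C.
  have C0 : 0 <= C by rewrite (le_trans _ (cC 0)).
  rewrite ler_norml /u le_max lexx/= ge_max ge_min lexx/= andbT.
  by rewrite (@le_trans _ _ 0)// oppr_le0.
have mu_ : measurable_fun [set: measurableTypeR R] u.
  apply: measurable_maxr => //; apply: measurable_minr => //.
  apply: measurableT_comp => //; apply: measurable_fun_limn_esup => n.
  apply/measurable_EFinP; exact: continuous_measurable_fun.
have mc : measurable_fun [set: measurableTypeR R] c.
  exact: continuous_measurable_fun.
have u0 : {ae @lebesgue_measure R, forall t, u t - c t = 0}.
  apply: (@ae_eq0_itv _ _ (C + C)).
  - exact: measurable_funB.
  - by move=> t; rewrite (le_trans (ler_normB _ _))// lerD.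
  move=> p q pq.
  have pqlty : (@lebesgue_measure R `[p, q]%classic < +oo)%E.
    by rewrite lebesgue_measure_itv/= lte_fin pq -EFinB ltry.
  have mI : measurable (`[p, q]%classic : set (measurableTypeR R)).
    exact: measurable_itv.
  rewrite RintegralB//; last 2 first.
    apply: (@bounded_integrable_lty _ _ _ _ _ _ C) => //.
    exact: measurable_funTS.
    apply: (@bounded_integrable_lty _ _ _ _ _ _ C) => //.
    exact: measurable_funTS.
  apply/eqP; rewrite subr_eq0; apply/eqP.
  suff H : \int[@lebesgue_measure R]_(t in `[p, q]) c_ n t @[n --> \oo] -->
      \int[@lebesgue_measure R]_(t in `[p, q]) u t.
    exact: (cvg_unique _ H (intc p q pq)).
  apply: (@bounded_cvg_Rintegral _ (measurableTypeR R) R (@lebesgue_measure R)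
    `[p, q]%classic c_ u C) => //.
  - by move=> n; apply: measurable_funTS; exact: continuous_measurable_fun.
  - exact: measurable_funTS.
  - apply: (@filterS _ _ (ae_filter_ringOfSetsType (@lebesgue_measure R)) _ _ _ cg).
    by move=> t ct _; rewrite uE.
apply: (@filterS2 _ _ (ae_filter_ringOfSetsType (@lebesgue_measure R)) _ _ _ _ cg u0).
by move=> t ct /eqP; rewrite subr_eq0 uE// => /eqP.
Unshelve. all: end_near. Qed.

(** Averages of the transforms over segments are integrals of functions
   vanishing at infinity, so vague convergence passes to them; the transform of
   the limit is then identified with the almost everywhere limit. *)
Lemma vague_cvg_transform_ae (R : realType) (w W : R -> R)
    (a_ b_ : nat -> finmeasure R)
    (a b : finmeasure R)
    (D : set R) (gamma : R -> R) (C : R) :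
  (forall u, `|w u| <= 1) -> (forall u v, `|w u - w v| <= `|u - v|) ->
  (forall u, `|W u| <= 1) -> (forall u : R, is_derive u (1 : R) W (w u)) ->
  countable D ->
  (forall n, fine (a_ n setT) <= C) -> fine (a setT) <= C ->
  (forall n, fine (b_ n setT) <= C) -> fine (b setT) <= C ->
  (forall x y, x < y -> ~ D x -> ~ D y ->
    fine (a_ n `]x, y]%classic) @[n --> \oo] --> fine (a `]x, y]%classic)) ->
  (forall x y, x < y -> ~ D x -> ~ D y ->
    fine (b_ n `]x, y]%classic) @[n --> \oo] --> fine (b `]x, y]%classic)) ->
  {ae @lebesgue_measure R, forall t,
    (\int[a_ n]_x w (t * x) - \int[b_ n]_x w (t * x)) @[n --> \oo] --> gamma t} ->
  {ae @lebesgue_measure R, forall t,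
    gamma t = \int[a]_x w (t * x) - \int[b]_x w (t * x)}.
Proof.
move=> w1 wl W1 dW cD a_C aC b_C bC aa bb.
have cont (m : finmeasure R) :
    continuous (fun t : R => \int[m]_x w (t * x)).
  exact: measure_transform_continuous.
have bnd (m : finmeasure R) t :
    fine (m setT) <= C -> `|\int[m]_x w (t * x)| <= C.
  by apply: le_trans; exact: measure_transform_bound.
have bnd2 (m m' : finmeasure R) t :
    fine (m setT) <= C -> fine (m' setT) <= C ->
    `|\int[m]_x w (t * x) - \int[m']_x w (t * x)| <= C + C.
  by move=> mC m'C; rewrite (le_trans (ler_normB _ _))// lerD// bnd.
move=> cg; apply: (ae_limit_eq (C := C + C) _ _ _ _ cg).
- by move=> n t; apply: cvgB; exact: cont.
- by move=> t; apply: cvgB; exact: cont.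
- by move=> n t; exact: bnd2.
- by move=> t; exact: bnd2.
move=> p q pq.
have iE (m m' : finmeasure R) :
    \int[@lebesgue_measure R]_(t in `[p, q])
      (\int[m]_x w (t * x) - \int[m']_x w (t * x)) =
    \int[m]_x segment_transform w p q x - \int[m']_x segment_transform w p q x.
  have it (m0 : finmeasure R) :
      (@lebesgue_measure R).-integrable `[p, q]
        (EFin \o (fun t => \int[m0]_x w (t * x))).
    apply: (@bounded_integrable_lty _ _ _ _ _ _ (fine (m0 setT))) => //.
    - by rewrite /= lebesgue_measure_itv/= lte_fin pq -EFinB ltry.
    - by apply: measurable_funTS; exact: continuous_measurable_fun.
    - by move=> t _; exact: measure_transform_bound.
  by rewrite RintegralB// !(segment_transform_fubini w1 wl pq).
under eq_fun do rewrite iE; rewrite iE.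
have st (m_ : nat -> finmeasure R)
    (m : finmeasure R) :
    (forall n, fine (m_ n setT) <= C) -> fine (m setT) <= C ->
    (forall x y, x < y -> ~ D x -> ~ D y ->
      fine (m_ n `]x, y]%classic) @[n --> \oo] --> fine (m `]x, y]%classic)) ->
    \int[m_ n]_x segment_transform w p q x @[n --> \oo] -->
    \int[m]_x segment_transform w p q x.
  move=> m_C mC mm.
  have lip := segment_transform_lip w1 wl pq.
  apply: (vague_cvg_Rintegral cD m_C mC mm lip).
  exact: (segment_transform_decay w1 wl W1 dW pq).
by apply: cvgB; exact: st.
Qed.

(** * Lower semicontinuity of the total variation *)

Lemma sum_increments_le_total_variation (R : realType) (f : R -> R)
    (y_ : nat -> R) (N : nat) :
  (forall i, (i < N)%N -> y_ i <= y_ i.+1) ->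
  ((\sum_(i < N) `|f (y_ i.+1) - f (y_ i)|)%:E <=
   total_variation (y_ 0%N) (y_ N) f)%E.
Proof.
have mono n : (forall i, (i < n)%N -> y_ i <= y_ i.+1) -> y_ 0%N <= y_ n.
  elim: n => // n IH yS; rewrite (le_trans (IH _)) ?yS// => i /ltnW.
  exact: yS.
elim: N => [|N IH] yS; first by rewrite big_ord0 total_variationxx.
have yN i : (i < N)%N -> y_ i <= y_ i.+1 by move=> /ltnW; exact: yS.
rewrite big_ord_recr/= EFinD (total_variationD f (mono N yN) (yS N _))//.
by apply: leeD; [exact: IH|exact/total_variation_ge/yS].
Qed.

(** The points of a partition are moved to the right, off D, by a common small
   translation; right continuity brings them back. *)
Lemma total_variationR_le_limit (R : realType) (u : nat -> R -> R) (G : R -> R)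
    (D : set R) (c : R) :
  countable D -> right_continuous G ->
  (forall x y, ~ D x -> ~ D y -> u k y - u k x @[k --> \oo] --> G y - G x) ->
  (\forall k \near \oo, (total_variationR (u k) <= c%:E)%E) ->
  (total_variationR G <= c%:E)%E.
Proof.
move=> cD Grc uG uc; apply: ge_ereal_sup => _ [[a b] /= ab <-].
apply: ge_ereal_sup => _ [_ [s abs <-] <-]; rewrite lee_fin.
pose y_ i := nth b (a :: s) i.
have yS i : (i < size s)%N -> y_ i <= y_ i.+1.
  by move=> si; case: abs => /(pathP b) /(_ i si) /ltW.
have sumE f : variation a b f s = \sum_(i < size s) `|f (y_ i.+1) - f (y_ i)|.
  by rewrite /variation big_mkord.
have shifted t : (forall i, ~ D (y_ i + t)) ->
    \sum_(i < size s) `|G (y_ i.+1 + t) - G (y_ i + t)| <= c.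
  move=> tD.
  have scvg : \sum_(i < size s) `|u k (y_ i.+1 + t) - u k (y_ i + t)|
      @[k --> \oo] --> \sum_(i < size s) `|G (y_ i.+1 + t) - G (y_ i + t)|.
    apply: (@cvg_sum_ord R (fun i k => `|u k (y_ i.+1 + t) - u k (y_ i + t)|)
      (fun i => `|G (y_ i.+1 + t) - G (y_ i + t)|)) => i.
    by apply: cvg_norm; apply: uG.
  apply: (ler_cvg_to scvg (@cvg_cst _ c _ _ _)).
  apply: filterS uc => k uc; rewrite -lee_fin; apply: le_trans uc.
  have yt i : (i < size s)%N -> y_ i + t <= y_ i.+1 + t.
    by move=> si; rewrite lerD2r yS.
  apply: (le_trans (@sum_increments_le_total_variation _ (u k)
    (fun i => y_ i + t) _ yt)).
  apply: total_variation_leR; rewrite lerD2r.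
  exact: itv_partition_nth_ge (ltnSn _) abs.
have theta_ex j : exists t, 0 < t < j.+1%:R^-1 /\ forall i, ~ D (y_ i + t).
  by apply: countable_avoid_shift.
pose th j := sval (cid (theta_ex j)).
have th0 j : 0 < th j by have [/andP[]] := svalP (cid (theta_ex j)).
have thj j : th j < j.+1%:R^-1 by have [/andP[]] := svalP (cid (theta_ex j)).
have thD j i : ~ D (y_ i + th j) by have [_] := svalP (cid (theta_ex j)).
have thcvg : th j @[j --> \oo] --> (0 : R).
  apply: (squeeze_cvgr (f := fun=> 0) (h := fun j => j.+1%:R^-1)).
  - by near=> j; rewrite !ltW.
  - exact: cvg_cst.
  - exact: cvg_harmonic.
have Gy i : G (y_ i + th j) @[j --> \oo] --> G (y_ i).
  have /cvg_at_rightP := Grc (y_ i); apply; split.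
    by move=> j; rewrite ltrDl.
  rewrite -[X in _ --> X]addr0; apply: cvgD => //; exact: cvg_cst.
have scvg : \sum_(i < size s) `|G (y_ i.+1 + th j) - G (y_ i + th j)|
    @[j --> \oo] --> \sum_(i < size s) `|G (y_ i.+1) - G (y_ i)|.
  apply: (@cvg_sum_ord R (fun i j => `|G (y_ i.+1 + th j) - G (y_ i + th j)|)
    (fun i => `|G (y_ i.+1) - G (y_ i)|)) => i.
  by apply: cvg_norm; apply: cvgB.
rewrite sumE; apply: (ler_cvg_to scvg (@cvg_cst _ c _ _ _)).
by near=> j; apply: shifted => i; exact: thD.
Unshelve. all: end_near. Qed.

(** * Uniqueness of the transform in V *)

Lemma normc_ge_Im (R : rcfType) (x : R[i]) : (`|complex.Im x|%:C)%C <= `|x|.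
Proof.
case: x => a b; rewrite normc_def lecR /= -sqrtr_sqr.
by rewrite ler_sqrt ?lerDr ?sqr_ge0// addr_ge0 ?sqr_ge0.
Qed.

Lemma cvg_Re_Im (R : realType) (T : Type) (F : set_system T) {FF : Filter F}
    (f : T -> R[i]) (l : R[i]) :
  f x @[x --> F] --> l ->
  (complex.Re (f x) @[x --> F] --> complex.Re l) /\
  (complex.Im (f x) @[x --> F] --> complex.Im l).
Proof.
move=> /cvgrPdist_lt fl.
have fle (e : R) : 0 < e -> \forall x \near F, `|l - f x| < (e%:C)%C.
  by move=> e0; apply: fl; rewrite ltcR.
split; apply/cvgrPdist_lt => e /fle; apply: filterS => x fx.
  rewrite -ltcR; apply: le_lt_trans fx; apply: le_trans (normc_ge_Re _).
  by case: (l) (f x) => [a b] [c d].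
rewrite -ltcR; apply: le_lt_trans fx; apply: le_trans (normc_ge_Im _).
by case: (l) (f x) => [a b] [c d].
Qed.

Lemma limn_esup_lt (R : realType) (u : nat -> \bar R) (c : \bar R) :
  (limn_esup u < c)%E -> \forall n \near \oo, (u n < c)%E.
Proof.
move=> /ereal_inf_lt [_ [V VF <-] Vc]; apply: filterS VF => n Vn.
by apply: le_lt_trans Vc; apply: ereal_sup_ubound; exists n.
Qed.

Lemma limn_esup_le (R : realType) (u : nat -> \bar R) (c : \bar R) :
  (\forall n \near \oo, (u n <= c)%E) -> (limn_esup u <= c)%E.
Proof.
move=> uc; apply: (@le_trans _ _ (ereal_sup (u @` [set n | (u n <= c)%E]))).
  by apply: ereal_inf_lbound; exists [set n | (u n <= c)%E].
by apply: ge_ereal_sup => _ [n un <-].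
Qed.

Lemma ae_lebesgue_dense (R : realType) (P : R -> Prop) (t e : R) :
  {ae @lebesgue_measure R, forall s, P s} -> 0 < e ->
  exists s, `|t - s| < e /\ P s.
Proof.
move=> [A [mA A0 PA]] e0; apply: contrapT => H.
have IA : `]t - e, t + e[ `<=` A.
  move=> s; rewrite /= in_itv/= => /andP[s1 s2]; apply: PA => /= Ps; apply: H.
  by exists s; split => //; rewrite ltr_norml; lra.
have I0 : @lebesgue_measure R `]t - e, t + e[%classic = (e + e)%:E.
  rewrite lebesgue_measure_itv/= lte_fin ifT; last by lra.
  by rewrite -EFinB; congr (_%:E); lra.
have : ((e + e)%:E <= 0)%E.
  by rewrite -I0 -A0; apply: le_measure => //; rewrite inE.
by rewrite lee_fin; lra.
Qed.

(** A set of full Lebesgue measure is dense, so two functions equal almost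
   everywhere agree where both are continuous. *)
Lemma ae_eq_at_continuity (R : realType) (u v : R -> R) (t : R) :
  {ae @lebesgue_measure R, forall s, u s = v s} ->
  {for t, continuous u} -> {for t, continuous v} -> u t = v t.
Proof.
move=> uv cu cv; apply/eqP; rewrite -subr_eq0; apply: contraT => uvt.
have e0 : 0 < `|u t - v t| by rewrite normr_gt0.
have cuv : u s - v s @[s --> t] --> u t - v t by exact: cvgB cu cv.
have /cvgrPdist_lt /(_ _ e0) [d /= d0 H] := cuv.
have [s [ts us]] := ae_lebesgue_dense t uv d0.
by have := H s ts; rewrite /= us subrr subr0 ltxx.
Qed.

Lemma derive_bound1_lipschitz (R : realType) (f df : R -> R) (u v : R) :
  (forall x : R, is_derive x (1 : R) f (df x)) -> (forall x, `|df x| <= 1) ->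
  `|f u - f v| <= `|u - v|.
Proof.
move=> fdf df1.
wlog uv : u v / u < v => [H|].
  have [uv|vu|->] := ltgtP u v; first exact: H.
    by rewrite distrC (distrC u); exact: H.
  by rewrite !subrr.
have cf : {within `[u, v], continuous f}.
  by apply: derivable_within_continuous => x _; case: (fdf x).
have [c _ fE] := MVT uv (fun x _ => fdf x) cf.
by rewrite distrC fE normrM distrC ler_piMl.
Qed.

Lemma cos_lipschitz (R : realType) (u v : R) : `|cos u - cos v| <= `|u - v|.
Proof.
apply: (derive_bound1_lipschitz (df := fun x => - sin x)) => x.
by rewrite normrN sin_max.
Qed.

Lemma sin_lipschitz (R : realType) (u v : R) : `|sin u - sin v| <= `|u - v|.
Proof.
apply: (derive_bound1_lipschitz (df := cos)) => x.
exact: cos_max.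
Qed.

Lemma class_V_representation (R : realType) (G : R -> R) : class_V G ->
  exists a b : finmeasure R,
    (forall x, G x = fine (a `]-oo, x]%classic) - fine (b `]-oo, x]%classic)) /\
    (forall t, fourier_stieltjes G t =
      Complex (\int[a]_x cos (t * x) - \int[b]_x cos (t * x))
              (\int[a]_x sin (t * x) - \int[b]_x sin (t * x))).
Proof.
move=> /class_V_jordan [P [N [PV NV Pnd Nnd GPN]]].
have [a [aP _]] := nondecreasing_class_V_measure PV Pnd.
have [b [bN _]] := nondecreasing_class_V_measure NV Nnd.
exists a, b; split=> [x|t]; last exact: fourier_stieltjesE.
rewrite GPN -[P x]/(fine (P x)%:E) -[N x]/(fine (N x)%:E) -aP -bN.
by [].
Qed.

Lemma fourier_stieltjes_continuous (R : realType) (G : R -> R) : class_V G ->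
  continuous (fun t => complex.Re (fourier_stieltjes G t)) /\
  continuous (fun t => complex.Im (fourier_stieltjes G t)).
Proof.
move=> /class_V_representation [a [b [_ fsE]]].
have contc (m : finmeasure R) :
    continuous (fun t : R => \int[m]_x cos (t * x)).
  by apply: measure_transform_continuous; [exact: cos_max|exact: cos_lipschitz].
have conts (m : finmeasure R) :
    continuous (fun t : R => \int[m]_x sin (t * x)).
  by apply: measure_transform_continuous; [exact: sin_max|exact: sin_lipschitz].
split.
  rewrite (_ : (fun t => _) = fun t => \int[a]_x cos (t * x) -
    \int[b]_x cos (t * x)); last by apply/funext => t; rewrite fsE.
  by move=> t; apply: cvgB; exact: contc.
rewrite (_ : (fun t => _) = fun t => \int[a]_x sin (t * x) -
  \int[b]_x sin (t * x)); last by apply/funext => t; rewrite fsE.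
by move=> t; apply: cvgB; exact: conts.
Qed.

(** By continuity the transforms agree everywhere.  With G = a - b and
   H = a' - b', the finite measures a + b' and a' + b have the same transform,
   hence the same distribution function. *)
Lemma fourier_stieltjes_uniq (R : realType) (G H : R -> R) :
  class_V G -> class_V H ->
  {ae @lebesgue_measure R, forall t,
    fourier_stieltjes G t = fourier_stieltjes H t} -> G = H.
Proof.
move=> GV HV GH.
have [cG sG] := fourier_stieltjes_continuous GV.
have [cH sH] := fourier_stieltjes_continuous HV.
have aef := ae_filter_ringOfSetsType (@lebesgue_measure R).
have GHE t : fourier_stieltjes G t = fourier_stieltjes H t.
  have reE : complex.Re (fourier_stieltjes G t) =
      complex.Re (fourier_stieltjes H t).
    apply: (ae_eq_at_continuity (u := fun t => complex.Re (fourier_stieltjes G t))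
      (v := fun t => complex.Re (fourier_stieltjes H t)) _ (cG t) (cH t)).
    by apply: (@filterS _ _ aef _ _ _ GH) => s ->.
  have imE : complex.Im (fourier_stieltjes G t) =
      complex.Im (fourier_stieltjes H t).
    apply: (ae_eq_at_continuity (u := fun t => complex.Im (fourier_stieltjes G t))
      (v := fun t => complex.Im (fourier_stieltjes H t)) _ (sG t) (sH t)).
    by apply: (@filterS _ _ aef _ _ _ GH) => s ->.
  by move: reE imE; case: (fourier_stieltjes _ _) (fourier_stieltjes _ _) =>
    [? ?] [? ?] /= -> ->.
have [a [b [Gab fsG]]] := class_V_representation GV.
have [a' [b' [Hab fsH]]] := class_V_representation HV.
have mfin (m n : finmeasure R) :
    (measure_add m n setT < +oo)%E.
  by rewrite measure_addE lte_add_pinfty// finite_measure_lty.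
have [m1 m1E] := finite_measure_of_measure (mfin a b').
have [m2 m2E] := finite_measure_of_measure (mfin a' b).
have intE (w : R -> R) (m n k : finmeasure R) t :
    continuous w -> (forall u, `|w u| <= 1) ->
    k = measure_add m n :> (set _ -> \bar R) ->
    \int[k]_x w (t * x) = \int[m]_x w (t * x) + \int[n]_x w (t * x).
  move=> cw w1 kE; rewrite -(@Rintegral_measure_add _ _ _ _ _ _ 1)//.
    by apply: Rintegral_eq_measure => A _ _; exact: (congr1 (@^~ A) kE).
  apply: measurableT_comp; last exact: measurable_funM.
  exact: continuous_measurable_fun.
have m12 x : m1 `]-oo, x]%classic = m2 `]-oo, x]%classic.
  apply: finite_measure_fourier_uniq => t.
    have := GHE t; rewrite fsG fsH => -[+ _].
    rewrite (intE cos a b' m1)//; [|exact: continuous_cos|exact: cos_max].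
    rewrite (intE cos a' b m2)//; [|exact: continuous_cos|exact: cos_max].
    by lra.
  have := GHE t; rewrite fsG fsH => -[_].
  rewrite (intE sin a b' m1)//; [|exact: continuous_sin|exact: sin_max].
  rewrite (intE sin a' b m2)//; [|exact: continuous_sin|exact: sin_max].
  by lra.
apply/funext => x; rewrite Gab Hab.
have mI : measurable (`]-oo, x]%classic : set (measurableTypeR R)).
  exact: measurable_itv.
have : fine (m1 `]-oo, x]%classic) = fine (m2 `]-oo, x]%classic) by rewrite m12.
have addE (k m n : finmeasure R) :
    k = measure_add m n :> (set _ -> \bar R) ->
    fine (k `]-oo, x]%classic) =
    fine (m `]-oo, x]%classic) + fine (n `]-oo, x]%classic).
  move=> kE; rewrite -fineD; [|exact: fin_num_measure..].
  by rewrite -measure_addE; congr fine; exact: (congr1 (@^~ _) kE).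
by rewrite (addE _ _ _ m1E) (addE _ _ _ m2E); lra.
Qed.

(** * Basic convergence *)

Lemma increasing_cvg_infty (s : nat -> nat) :
  {homo s : m n / (m < n)%N} -> s k @[k --> \oo] --> \oo.
Proof.
move=> sinc; apply/cvgnyPge => A; near=> k.
have sk j : (j <= s j)%N.
  by elim: j => // j IH; rewrite (leq_ltn_trans IH)// sinc.
by rewrite (leq_trans _ (sk k))//; near: k; exact: nbhs_infty_ge.
Unshelve. all: end_near. Qed.

(** The bound behind B <= g(0) + 2 M: its right-hand side is also
   G(+oo) + 2 N(+oo) for G = P - N. *)
Lemma total_variationR_sub_le (R : realType) (P N : R -> R) :
  class_V P -> class_V N -> nondecreasing P -> nondecreasing N ->
  (total_variationR (fun x => P x - N x)%R <= (at_pinfty P + at_pinfty N)%:E)%E.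
Proof.
move=> PV NV Pnd Nnd; apply: ge_ereal_sup => _ [[a b] /= ab <-].
have := total_variation_le P (\- N) ab; rewrite total_variationN.
move=> /le_trans; apply; rewrite EFinD.
have TVE F : class_V F -> nondecreasing F ->
    (total_variation a b F <= (at_pinfty F)%:E)%E.
  move=> FV Fnd; apply: (le_trans (total_variation_leR F ab)).
  rewrite -[at_pinfty F]subr0; apply: nondecreasing_total_variationR_le => //.
  exact: nondecreasing_class_V_bound.
by apply: leeD; exact: TVE.
Qed.

Lemma class_V_sub (R : realType) (P N : R -> R) :
  class_V P -> class_V N -> nondecreasing P -> nondecreasing N ->
  class_V (fun x => P x - N x).
Proof.
move=> PV NV Pnd Nnd; have [_ Prc P0] := PV; have [_ Nrc N0] := NV; split.
- exact: le_lt_trans (total_variationR_sub_le PV NV Pnd Nnd) (ltry _).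
- by move=> x; apply: cvgB; [exact: Prc|exact: Nrc].
- by rewrite -[X in _ --> X](subr0 (0 : R)); exact: cvgB.
Qed.

Lemma fourier_stieltjes0 (R : realType) (G P N : R -> R) :
  class_V P -> class_V N -> nondecreasing P -> nondecreasing N ->
  (forall x, G x = P x - N x) ->
  fourier_stieltjes G 0 = Complex (at_pinfty P - at_pinfty N) 0.
Proof.
move=> PV NV Pnd Nnd GPN.
have [a [aP aT]] := nondecreasing_class_V_measure PV Pnd.
have [b [bN bT]] := nondecreasing_class_V_measure NV Nnd.
rewrite (fourier_stieltjesE 0 aP bN GPN).
have sin0E (m : finmeasure R) :
    \int[m]_x sin (0 * x) = 0.
  under eq_Rintegral do rewrite mul0r sin0.
  by rewrite Rintegral_finite_measure_cst mul0r.
by rewrite !Rintegral_cos0 !sin0E aT bT subrr.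
Qed.

Lemma at_pinfty_sub (R : realType) (G P N : R -> R) :
  class_V P -> class_V N -> nondecreasing P -> nondecreasing N ->
  (forall x, G x = P x - N x) -> at_pinfty G = at_pinfty P - at_pinfty N.
Proof.
move=> PV NV Pnd Nnd GPN.
have : G x @[x --> +oo] --> at_pinfty P - at_pinfty N.
  have -> : G = fun x => P x - N x by apply/funext.
  by apply: cvgB; exact: nondecreasing_class_V_cvg.
by move=> /cvg_lim; apply.
Qed.

(** Helly's theorem, applied to the positive and then to the negative parts,
   gives limits P and N off their jumps.  Subtracting the limits at -oo puts
   them in V without changing their increments: mass may have escaped to
   infinity, which is why the test functions must vanish there. *)
Lemma basic_subsequence (R : realType) (Gp Gm : nat -> R -> R) (g : R -> R[i])
    (C : R) :
  (forall n, class_V (Gp n)) -> (forall n, class_V (Gm n)) ->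
  (forall n, nondecreasing (Gp n)) -> (forall n, nondecreasing (Gm n)) ->
  (forall n, at_pinfty (Gp n) <= C) -> (forall n, at_pinfty (Gm n) <= C) ->
  {ae @lebesgue_measure R, forall t,
    fourier_stieltjes (fun x => Gp n x - Gm n x) t @[n --> \oo] --> g t} ->
  exists s : nat -> nat, {homo s : m n / (m < n)%N} /\
  exists D : set R, countable D /\
  exists G : R -> R, [/\ class_V G,
    (forall x y, ~ D x -> ~ D y ->
      (Gp (s k) y - Gm (s k) y) - (Gp (s k) x - Gm (s k) x)
        @[k --> \oo] --> G y - G x) &
    {ae @lebesgue_measure R, forall t, g t = fourier_stieltjes G t}].
Proof.
move=> GpV GmV Gpnd Gmnd GpC GmC gae.
have bound F : class_V F -> nondecreasing F -> at_pinfty F <= C ->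
    forall x, 0 <= F x <= C.
  move=> FV Fnd FC x; have /andP[F0 F1] := nondecreasing_class_V_bound FV Fnd x.
  by rewrite F0 (le_trans F1).
have [s1 [s1inc [P [Pnd Prc PC GpP]]]] :=
  helly_selection Gpnd (fun n => bound _ (GpV n) (Gpnd n) (GpC n)).
have [s2 [s2inc [N [Nnd Nrc NC GmN]]]] :=
  helly_selection (fun n => Gmnd (s1 n))
    (fun n => bound _ (GmV (s1 n)) (Gmnd (s1 n)) (GmC (s1 n))).
pose s k := s1 (s2 k).
have sinc : {homo s : m n / (m < n)%N} by move=> m n mn; exact/s1inc/s2inc.
exists s; split => //.
pose D := [set x | discontinuity P x] `|` [set x | discontinuity N x].
have cD : countable D.
  rewrite /D -bigcup2E; apply: bigcup_countable => // -[|[|i]] _ /=;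
    [exact: discontinuity_countableT..|exact: countable0].
exists D; split => //.
have DP x : ~ D x -> Gp (s k) x @[k --> \oo] --> P x.
  move=> Dx; have Px : ~ discontinuity P x by move=> dx; apply: Dx; left.
  exact: (cvg_comp _ _ (increasing_cvg_infty s2inc) (GpP x Px)).
have DN x : ~ D x -> Gm (s k) x @[k --> \oo] --> N x.
  by move=> Dx; apply: GmN => dx; apply: Dx; right.
pose P0 x := P x - inf (range P); pose N0 x := N x - inf (range N).
have PV : class_V P0 := nondecreasing_class_V Pnd Prc PC.
have NV : class_V N0 := nondecreasing_class_V Nnd Nrc NC.
have P0nd : nondecreasing P0 by move=> x y xy; rewrite lerD2r Pnd.
have N0nd : nondecreasing N0 by move=> x y xy; rewrite lerD2r Nnd.
have inf_ge0 (F : R -> R) : (forall x, 0 <= F x <= C) -> 0 <= inf (range F).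
  move=> FC; apply: lb_le_inf; first by exists (F 0), 0.
  by move=> _ [x _ <-]; have /andP[] := FC x.
have mass F : class_V F -> nondecreasing F -> (forall x, F x <= C) ->
    at_pinfty F <= C.
  move=> FV Fnd FC.
  apply: (ler_cvg_to (nondecreasing_class_V_cvg FV Fnd) (@cvg_cst _ C _ _ _)).
  by near=> x.
have P0C : at_pinfty P0 <= C.
  apply: mass => // x; have /andP[_ ?] := PC x; have := inf_ge0 P PC.
  by rewrite /P0; lra.
have N0C : at_pinfty N0 <= C.
  apply: mass => // x; have /andP[_ ?] := NC x; have := inf_ge0 N NC.
  by rewrite /N0; lra.
have [a [aP aT]] := nondecreasing_class_V_measure PV P0nd.
have [b [bN bT]] := nondecreasing_class_V_measure NV N0nd.
pose a_ k := sval (cid (nondecreasing_class_V_measure (GpV (s k)) (Gpnd (s k)))).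
pose b_ k := sval (cid (nondecreasing_class_V_measure (GmV (s k)) (Gmnd (s k)))).
have a_P k x : a_ k `]-oo, x]%classic = (Gp (s k) x)%:E.
  by rewrite /a_; case: cid => mu [].
have a_T k : a_ k setT = (at_pinfty (Gp (s k)))%:E.
  by rewrite /a_; case: cid => mu [].
have b_P k x : b_ k `]-oo, x]%classic = (Gm (s k) x)%:E.
  by rewrite /b_; case: cid => mu [].
have b_T k : b_ k setT = (at_pinfty (Gm (s k)))%:E.
  by rewrite /b_; case: cid => mu [].
have a_C k : fine (a_ k setT) <= C by rewrite a_T; exact: GpC.
have b_C k : fine (b_ k setT) <= C by rewrite b_T; exact: GmC.
have aC : fine (a setT) <= C by rewrite aT.
have bC : fine (b setT) <= C by rewrite bT.
have aa x y : x < y -> ~ D x -> ~ D y ->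
    fine (a_ n `]x, y]%classic) @[n --> \oo] --> fine (a `]x, y]%classic).
  move=> /ltW xy Dx Dy; rewrite (finite_measure_itvoc aP xy).
  under eq_fun => n do rewrite (finite_measure_itvoc (a_P n) xy).
  rewrite /= /P0 opprB addrA subrK.
  by apply: cvgB; exact: DP.
have bb x y : x < y -> ~ D x -> ~ D y ->
    fine (b_ n `]x, y]%classic) @[n --> \oo] --> fine (b `]x, y]%classic).
  move=> /ltW xy Dx Dy; rewrite (finite_measure_itvoc bN xy).
  under eq_fun => n do rewrite (finite_measure_itvoc (b_P n) xy).
  rewrite /= /N0 opprB addrA subrK.
  by apply: cvgB; exact: DN.
have aef := ae_filter_ringOfSetsType (@lebesgue_measure R).
have gsub t : fourier_stieltjes (fun x => Gp n x - Gm n x) t @[n --> \oo] --> g t ->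
    ((\int[a_ n]_x cos (t * x) - \int[b_ n]_x cos (t * x)) @[n --> \oo] -->
      complex.Re (g t)) /\
    ((\int[a_ n]_x sin (t * x) - \int[b_ n]_x sin (t * x)) @[n --> \oo] -->
      complex.Im (g t)).
  move=> gt; have := cvg_comp _ _ (increasing_cvg_infty sinc) gt.
  move=> /cvg_Re_Im[]; rewrite /comp.
  have fsE k := @fourier_stieltjesE R _ _ _ t _ _ (a_P k) (b_P k) (fun x => erefl).
  under eq_fun => k do rewrite fsE /=.
  move=> H1; under eq_fun => k do rewrite fsE /=.
  by [].
have ReE : {ae @lebesgue_measure R, forall t, complex.Re (g t) =
    \int[a]_x cos (t * x) - \int[b]_x cos (t * x)}.
  apply: (vague_cvg_transform_ae (w := cos) (W := sin) (D := D) (C := C) _ _ _ _ cD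
    a_C aC b_C bC aa bb).
  - exact: cos_max.
  - exact: cos_lipschitz.
  - exact: sin_max.
  - by apply: (@filterS _ _ aef _ _ _ gae) => t /gsub[].
have ImE : {ae @lebesgue_measure R, forall t, complex.Im (g t) =
    \int[a]_x sin (t * x) - \int[b]_x sin (t * x)}.
  apply: (vague_cvg_transform_ae (w := sin) (W := fun u => - cos u) (D := D) (C := C)
    _ _ _ _ cD a_C aC b_C bC aa bb).
  - exact: sin_max.
  - exact: sin_lipschitz.
  - by move=> u; rewrite normrN cos_max.
  - by move=> u; apply: is_derive_eq; rewrite opprK.
  - by apply: (@filterS _ _ aef _ _ _ gae) => t /gsub[].
exists (fun x => P0 x - N0 x); split.
- exact: class_V_sub.
- move=> x y Dx Dy.
  have -> : P0 y - N0 y - (P0 x - N0 x) = (P y - N y) - (P x - N x).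
    by rewrite /P0 /N0; lra.
  by apply: cvgB; apply: cvgB; (exact: DP || exact: DN).
- apply: (@filterS2 _ _ aef _ _ _ _ ReE ImE) => t reE imE.
  rewrite (fourier_stieltjesE t aP bN (fun x => erefl)).
  by move: reE imE; case: (g t) => x y /= -> ->.
Unshelve. all: end_near. Qed.

Theorem theorem2 (R : realType) (G_ Gp Gm : nat -> R -> R) (M : R)
    (g : R -> R[i])
    (GV : forall n, class_V (G_ n))
    (GpV : forall n, class_V (Gp n))
    (GmV : forall n, class_V (Gm n))
    (Gp_nd : forall n, nondecreasing (Gp n))
    (Gm_nd : forall n, nondecreasing (Gm n))
    (GE : forall n x, G_ n x = Gp n x - Gm n x)
    (GmM : limn_esup (fun n => (at_pinfty (Gm n))%:E) = M%:E)
    (gae : {ae @lebesgue_measure R, forall t,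
       fourier_stieltjes (G_ n) t @[n --> \oo] --> g t})
    (g0 : fourier_stieltjes (G_ n) 0 @[n --> \oo] --> g 0) :
  let B := limn_esup (fun n => total_variationR (G_ n)) in
  [/\ g 0 \is Num.real,
      B \is a fin_num,
      (B <= (complex.Re (g 0) + 2 * M)%:E)%E &
      exists G : R -> R,
        [/\ class_V G /\ (total_variationR G <= B)%E,
            {ae @lebesgue_measure R, forall t, g t = fourier_stieltjes G t} /\
            (forall t, {for t, continuous g} -> g t = fourier_stieltjes G t),
            (forall H : R -> R, class_V H ->
               {ae @lebesgue_measure R, forall t,
                  g t = fourier_stieltjes H t} ->
               H = G),
            basic_cvg G_ G &
            {for 0, continuous g} ->
              at_pinfty (G_ n) @[n --> \oo] --> at_pinfty G]].
Proof.
have GE' n : G_ n = fun x => Gp n x - Gm n x by apply/funext => x; exact: GE.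
have fs0 n : fourier_stieltjes (G_ n) 0 =
    Complex (at_pinfty (Gp n) - at_pinfty (Gm n)) 0.
  exact: fourier_stieltjes0.
have [re0 im0] := cvg_Re_Im g0.
have {}re0 : at_pinfty (Gp n) - at_pinfty (Gm n) @[n --> \oo] --> complex.Re (g 0).
  by move: re0; under eq_fun do rewrite fs0.
have {}im0 : complex.Im (g 0) = 0.
  move: im0; under eq_fun do rewrite fs0 /=.
  by move=> /(cvg_unique _ (@cvg_cst _ (0 : R) _ _ _)) <-.
have Gm_lt e : 0 < e -> \forall n \near \oo, at_pinfty (Gm n) < M + e.
  move=> e0; have : (limn_esup (fun n => (at_pinfty (Gm n))%:E) < (M + e)%:E)%E.
    by rewrite GmM lte_fin ltrDl.
  by move=> /limn_esup_lt; apply: filterS => n; rewrite lte_fin.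
have GpGm_lt e : 0 < e -> \forall n \near \oo,
    at_pinfty (Gp n) - at_pinfty (Gm n) < complex.Re (g 0) + e.
  move=> e0; move/cvgrPdist_lt : re0 => /(_ e e0); apply: filterS => n.
  by rewrite ltr_norml => /andP[]; lra.
have TV_le n : (total_variationR (G_ n) <=
    (at_pinfty (Gp n) + at_pinfty (Gm n))%:E)%E.
  by rewrite GE'; exact: total_variationR_sub_le.
move=> B.
have B_le : (B <= (complex.Re (g 0) + 2 * M)%:E)%E.
  apply/lee_addgt0Pr => e e0; rewrite -EFinD; apply: limn_esup_le.
  have e30 : 0 < e / 3 by rewrite divr_gt0.
  have := Gm_lt _ e30; have := GpGm_lt _ e30; apply: filterS2 => n H1 H2.
  by rewrite (le_trans (TV_le n))// lee_fin; lra.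
have B_ge0 : (0 <= B)%E.
  apply: limf_esup_ge0 => [[n _ /(_ n)]|n]; first by apply => /=.
  by rewrite (le_trans _ (total_variation_leR (G_ n) (lexx 0)))// total_variationxx.
have B_fin : B \is a fin_num.
  by rewrite ge0_fin_numE// (le_lt_trans B_le)// ltry.
have g0_real : g 0 \is Num.real.
  by move: im0; case: (g 0) => x y /= ->; rewrite complex_real.
have [n0 _ n0P] : \forall n \near \oo, at_pinfty (Gm n) <= M + 1 /\
    at_pinfty (Gp n) <= complex.Re (g 0) + M + 2.
  have := Gm_lt _ ltr01; have := GpGm_lt _ ltr01; apply: filterS2 => n H1 H2.
  by split; lra.
pose C := Num.max (M + 1) (complex.Re (g 0) + M + 2).
(* every subsequence has a basically convergent one, whose limit has the
   transform g almost everywhere and is therefore always the same G; the shift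
   by n0 skips the terms whose masses the hypotheses do not control *)
have sub s : {homo s : m n / (m < n)%N} ->
    exists s' : nat -> nat, {homo s' : m n / (m < n)%N} /\
    exists D : set R, countable D /\
    exists G : R -> R, [/\ class_V G,
      (forall x y, ~ D x -> ~ D y ->
        (G_ (s (s' k)) y - G_ (s (s' k)) x) @[k --> \oo] --> G y - G x) &
      {ae @lebesgue_measure R, forall t, g t = fourier_stieltjes G t}].
  move=> sinc; pose s0 k := s (k + n0)%N.
  have s_ge k : (k <= s k)%N.
    by elim: k => // k IH; rewrite (leq_ltn_trans IH)// sinc.
  have s0_ge k : (n0 <= s0 k)%N by rewrite (leq_trans _ (s_ge _))// leq_addl.
  have s0inc : {homo s0 : m n / (m < n)%N}.
    by move=> m n mn; apply: sinc; rewrite ltn_add2r.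
  have gae0 : {ae @lebesgue_measure R, forall t,
      fourier_stieltjes (fun x => Gp (s0 n) x - Gm (s0 n) x) t
        @[n --> \oo] --> g t}.
    apply: (@filterS _ _ (ae_filter_ringOfSetsType (@lebesgue_measure R))
      _ _ _ gae) => t gt.
    under eq_fun => n do rewrite -GE'.
    exact: (cvg_comp _ _ (increasing_cvg_infty s0inc) gt).
  have GpC k : at_pinfty (Gp (s0 k)) <= C.
    by have [_ H] := n0P _ (s0_ge k); rewrite le_max H orbT.
  have GmC k : at_pinfty (Gm (s0 k)) <= C.
    by have [H _] := n0P _ (s0_ge k); rewrite le_max H.
  have [s1 [s1inc [D [cD [G [GV' GD gG]]]]]] :=
    basic_subsequence (fun k => GpV (s0 k)) (fun k => GmV (s0 k))
      (fun k => @Gp_nd (s0 k)) (fun k => @Gm_nd (s0 k)) GpC GmC gae0.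
  exists (fun k => s1 k + n0)%N; split.
    by move=> m n mn; rewrite ltn_add2r s1inc.
  exists D; split => //; exists G; split => // x y Dx Dy.
  by under eq_fun => k do rewrite !GE; exact: GD.
have idinc : {homo idfun : m n / (m < n)%N} by [].
have [s' [s'inc [D [cD [G [GV' GD gG]]]]]] := sub _ idinc.
have uniq H : class_V H ->
    {ae @lebesgue_measure R, forall t, g t = fourier_stieltjes H t} -> H = G.
  move=> HV gH; apply: fourier_stieltjes_uniq => //.
  apply: (@filterS2 _ _ (ae_filter_ringOfSetsType (@lebesgue_measure R))
    _ _ _ _ gH gG) => t.
  by move=> <- <-.
have gcont t : {for t, continuous g} -> g t = fourier_stieltjes G t.
  move=> gt; have [rec imc] := cvg_Re_Im gt.
  have [fsr fsi] := fourier_stieltjes_continuous GV'.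
  have aef := ae_filter_ringOfSetsType (@lebesgue_measure R).
  have reE : complex.Re (g t) = complex.Re (fourier_stieltjes G t).
    apply: (ae_eq_at_continuity (u := fun t => complex.Re (g t))
      (v := fun t => complex.Re (fourier_stieltjes G t)) _ rec (fsr t)).
    by apply: (@filterS _ _ aef _ _ _ gG) => s ->.
  have imE : complex.Im (g t) = complex.Im (fourier_stieltjes G t).
    apply: (ae_eq_at_continuity (u := fun t => complex.Im (g t))
      (v := fun t => complex.Im (fourier_stieltjes G t)) _ imc (fsi t)).
    by apply: (@filterS _ _ aef _ _ _ gG) => s ->.
  by move: reE imE; case: (g t) (fourier_stieltjes _ _) => [? ?] [? ?] /= -> ->.
split => //; exists G; split => //.
- split => //; rewrite -(fineK B_fin); apply/lee_addgt0Pr => e e0.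
  have [_ Grc _] := GV'.
  rewrite -EFinD; apply: (total_variationR_le_limit (u := fun k => G_ (s' k)) cD Grc GD).
  have : (limn_esup (fun n => total_variationR (G_ n)) < (fine B + e)%:E)%E.
    by rewrite -/B -[X in (X < _)%E](fineK B_fin) lte_fin ltrDl.
  move=> /limn_esup_lt nB.
  have nB' : \forall k \near \oo,
      (total_variationR (G_ (s' k)) < (fine B + e)%:E)%E.
    exact: (increasing_cvg_infty s'inc nB).
  by apply: filterS nB' => k /ltW.
- move=> s /sub [s1 [s1inc [D1 [cD1 [H [HV HD gH]]]]]].
  exists s1; split => //; exists D1; split => //.
  by rewrite -(uniq H HV gH).
- move=> /gcont gG0.
  have -> : at_pinfty G = complex.Re (g 0).
    have [P [N [PV NV Pnd Nnd GPN]]] := class_V_jordan GV'.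
    rewrite gG0 (fourier_stieltjes0 PV NV Pnd Nnd GPN) /=.
    exact: at_pinfty_sub.
  rewrite (_ : (fun n => _) = fun n => at_pinfty (Gp n) - at_pinfty (Gm n))//.
  by apply/funext => n; exact: at_pinfty_sub.
Qed.
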